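(* Let $d\ge2$, $\omega\in\mathbb{S}^{d-1}$, $k\in\mathbb{R}^d$, $|k|=\kappa>0$, $\alpha\in\mathbb{R}$, $|\sin\alpha|\ge\delta>0$, $\varepsilon>0$. Let $\psi_0(x)=e^{ikx}$ and let $\psi_1$ be a radiation solution of $-\Delta\psi=\kappa^2\psi$ in $\mathcal{U}$ with far-field pattern $f_1$. Then for $\theta\in\mathbb{S}^+_\omega\setminus\mathcal{N}_{\omega,k,\varepsilon}$, $$f_1(\theta)=f_{1,1}(\theta)+\frac{1}{2i\sin\alpha}\,\mathcal{O}\left(\frac{1}{|x|^{\sigma}}\right)\quad\text{as }|x|\to+\infty,$$ where $f_{1,1}(\theta)$ is computed from the points $x=|x|\theta$ and $y=x+\zeta$ with $$\zeta=-\alpha\frac{\kappa\theta_{||}-k_{||}}{|\kappa\theta_{||}-k_{||}|^2},$$ and $\sigma=1/2$ for $d=2$, $\sigma=1$ for $d\ge3$.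
   Context: $\mathcal{U}=\mathbb{R}^d\setminus(\Omega\cup\partial\Omega)$ is connected, where $\Omega\subset\mathbb{R}^d$ is a bounded open domain with smooth boundary. For vectors, $kx=(k,x)$ denotes the Euclidean scalar product. A radiation solution is a $C^2$ solution $\psi_1$ of $-\Delta\psi_1=\kappa^2\psi_1$ in $\mathcal{U}$ satisfying $|x|^{\frac{d-1}{2}}\left(\frac{\partial}{\partial|x|}-i\kappa\right)\psi_1(x)\to0$ as $|x|\to+\infty$, uniformly in $x/|x|$. Its far-field pattern is the function $f_1$ on $\mathbb{S}^{d-1}$ such that $\psi_1(x)=\frac{e^{i\kappa|x|}}{|x|^{(d-1)/2}}f_1\left(\frac{x}{|x|}\right)+\mathcal{O}\left(|x|^{-(d+1)/2}\right)$ as $|x|\to+\infty$. For $s\ge0$: $X_{s,\omega}=\{x\in\mathbb{R}^d:(x,\omega)=s\}$; $\mathbb{S}^+_\omega=\{\theta\in\mathbb{S}^{d-1}:(\theta,\omega)>0\}$. Decompose $\theta=\theta_\perp+\theta_{||}$, $k=k_\perp+k_{||}$ with $\theta_\perp,k_\perp$ orthogonal to $X_{0,\omega}$ and $\theta_{||},k_{||}\in X_{0,\omega}$. For $\varepsilon>0$, $\mathcal{N}_{\omega,k,\varepsilon}=\{\theta\in\mathbb{S}^+_\omega:|k_{||}-\kappa\theta_{||}|<\varepsilon\}$. Both points lie in the same hyperplane: $x=\frac{s\theta}{(\theta,\omega)}\in X_{s,\omega}$ with $s=|x|(\theta,\omega)$, and $y=x+\zeta\in X_{s,\omega}$ since $\zeta\in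 X_{0,\omega}$. Define $a(x,k)=|x|^{(d-1)/2}\left(|\psi_0(x)+\psi_1(x)|^2-1\right)$, $x\in\mathcal{U}$, and $$f_{1,1}(\theta)=\frac1D\left(e^{i(ky-|k||y|)}a(x,k)-e^{i(kx-|k||x|)}a(y,k)\right),\qquad D=2i\sin\big(k\zeta+|k||x|-|k||y|\big).$$ So $f_{1,1}(\theta)$ depends also on $x$ (and $k,\alpha,\omega$). The quantities $\omega,k,\alpha,\delta,\varepsilon$ and $\theta$ are fixed in the limit $|x|\to+\infty$. *)

(* Defs.v *)
From HB Require Import structures.
From mathcomp Require Export all_boot all_order all_algebra.
From mathcomp Require Export all_classical all_reals all_analysis.
From mathcomp Require Export complex.
Set Implicit Arguments.
Unset Strict Implicit.
Unset Printing Implicit Defensive.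
Import Order.TTheory GRing.Theory Num.Theory.
Export numFieldNormedType.Exports.
Export ComplexField.Normc.
Local Open Scope classical_set_scope.
Local Open Scope ring_scope.
Local Open Scope complex_scope.

Section Euclidean.
Context {R : realType} {d : nat}.
Implicit Types (x y w : 'rV[R]_d) (A U : set 'rV[R]_d) (s : R).

Definition dot x y : R := \sum_i x 0 i * y 0 i.

(* The library norm on 'rV[R]_d is the sup norm; it induces the same topology
   and the same bounded sets as the Euclidean norm defined here. *)
Definition enorm x : R := Num.sqrt (dot x x).

Definition unit_sphere : set 'rV[R]_d := [set x | enorm x = 1].

Definition hyperplane s w : set 'rV[R]_d := [set x | dot x w = s].

Definition half_sphere w : set 'rV[R]_d :=
  [set x | unit_sphere x /\ 0 < dot x w].

(* For a unit vector w, x = perp w x + para w x is the decomposition along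
   the line orthogonal to hyperplane 0 w and hyperplane 0 w itself, see the
   three lemmas below. *)
Definition perp w x : 'rV[R]_d := dot x w *: w.
Definition para w x : 'rV[R]_d := x - perp w x.

Lemma perpDpara w x : perp w x + para w x = x.
Proof. by rewrite addrC subrK. Qed.

Lemma perp_orth w x z : hyperplane 0 w z -> dot (perp w x) z = 0.
Proof.
rewrite /hyperplane/= /dot => zw; under eq_bigr => i _ do
  rewrite mxE -mulrA [w 0 i * _]mulrC.
by rewrite -mulr_sumr zw mulr0.
Qed.

Lemma para_hyperplane w x : unit_sphere w -> hyperplane 0 w (para w x).
Proof.
rewrite /unit_sphere /hyperplane/= /enorm => w1.
have ww : dot w w = 1.
  have w0 : 0 <= dot w w by apply: sumr_ge0 => i _; rewrite -expr2 sqr_ge0.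
  by rewrite -(sqr_sqrtr w0) w1 expr1n.
rewrite {1}/dot; under eq_bigr => i _ do rewrite !mxE mulrBl -mulrA.
by rewrite sumrB -mulr_sumr -/(dot w w) ww mulr1 subrr.
Qed.

Definition boundary A : set 'rV[R]_d := closure A `\` interior A.

Definition exterior A : set 'rV[R]_d := ~` (A `|` boundary A).

Definition base i : 'rV[R]_d := delta_mx 0 i.

(* Class C^n on an open set U, for functions given on the whole space. *)
Fixpoint class_C n U (f : 'rV[R]_d -> R) : Prop :=
  (forall x, U x -> {for x, continuous f}) /\
  if n is m.+1 then
    forall i, (forall x, U x -> derivable f x (base i)) /\
              class_C m U (fun x => 'D_(base i) f x)
  else True.

(* Near each boundary point, A is the sublevel set of a C^oo function with
   nonvanishing gradient; the boundary is then locally its zero set. *)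
Definition smooth_boundary A : Prop :=
  forall p, boundary A p ->
  exists (V : set 'rV[R]_d) (rho : 'rV[R]_d -> R),
    [/\ open V, V p, (forall n, class_C n V rho),
        (exists i, 'D_(base i) rho p != 0)
      & forall x, V x -> (A x <-> rho x < 0)].

Definition bounded_smooth_domain A : Prop :=
  [/\ A !=set0, open A, connected A, bounded_set A & smooth_boundary A].

End Euclidean.

Section Helmholtz.
Context {R : realType} {d : nat}.
Implicit Types (x y v w k theta zeta : 'rV[R]_d) (U : set 'rV[R]_d).
Implicit Types (psi : 'rV[R]_d -> R[i]) (kappa alpha eps t : R).

(* e ^ (i t) *)
Definition expi t : R[i] := cos t +i* sin t.

(* Derivatives of complex-valued functions of real variables are taken on the
   real and imaginary parts. *)
Definition cderive psi v x : R[i] :=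
  'D_v (fun z => complex.Re (psi z)) x +i* 'D_v (fun z => complex.Im (psi z)) x.

Definition claplacian psi x : R[i] :=
  \sum_i cderive (cderive psi (base i)) (base i) x.

Definition cclass_C n U psi : Prop :=
  class_C n U (fun x => complex.Re (psi x)) /\
  class_C n U (fun x => complex.Im (psi x)).

(* (d - 1) / 2 *)
Definition decay : R := (d%:R - 1) / 2.

Definition sommerfeld U kappa psi : Prop :=
  forall e : R, 0 < e -> \forall r \near +oo_R,
  forall x, U x -> enorm x = r ->
    enorm x `^ decay *
      normc (cderive psi ((enorm x)^-1 *: x) x - 'i%C * kappa%:C * psi x) < e.

Definition radiation_solution U kappa psi : Prop :=
  [/\ cclass_C 2 U psi,
      forall x, U x -> - claplacian psi x = (kappa ^+ 2)%:C * psi x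
    & sommerfeld U kappa psi].

(* f is only evaluated on the unit sphere; the remainder is uniform in the
   direction x / |x|. *)
Definition far_field_pattern U kappa psi (f : 'rV[R]_d -> R[i]) : Prop :=
  exists C : R, \forall r \near +oo_R, forall x, U x -> enorm x = r ->
    normc (psi x - expi (kappa * enorm x) / (enorm x `^ decay)%:C
                   * f ((enorm x)^-1 *: x))
    <= C * enorm x `^ (- ((d%:R + 1) / 2)).

Definition excluded w k kappa eps : set 'rV[R]_d :=
  [set theta | half_sphere w theta /\
               enorm (para w k - kappa *: para w theta) < eps].

Definition psi0 k x : R[i] := expi (dot k x).

Definition a_fun psi k x : R :=
  enorm x `^ decay * (normc (psi0 k x + psi x) ^+ 2 - 1).

(* With y = x + zeta. *)
Definition f11 psi k x zeta : R[i] :=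
  let y := x + zeta in
  let D := 2 * 'i%C *
    (sin (dot k zeta + enorm k * enorm x - enorm k * enorm y))%:C in
  D^-1 * (expi (dot k y - enorm k * enorm y) * (a_fun psi k x)%:C
          - expi (dot k x - enorm k * enorm x) * (a_fun psi k y)%:C).

Definition zeta_vec w k kappa alpha theta : 'rV[R]_d :=
  let u := kappa *: para w theta - para w k in - (alpha / enorm u ^+ 2) *: u.

Definition sigma : R := if d == 2 then 2^-1 else 1.

End Helmholtz.
Arguments sigma R d : clear implicits.

(* Main.v *)
Require Import Defs.
From mathcomp Require Import ring lra.
Set Implicit Arguments.
Unset Strict Implicit.
Unset Printing Implicit Defensive.
Import Order.TTheory GRing.Theory Num.Theory.
Local Open Scope classical_set_scope.
Local Open Scope ring_scope.
Local Open Scope complex_scope.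

(* With x = r theta and y = x + zeta, the leading terms of a(x) and a(y) form a
   2 x 2 linear system for f1(theta) and its conjugate, with determinant D close
   to 2 i sin alpha, provided that the far-field pattern is Lipschitz at theta,
   for y / |y| is only within O(1 / r) of theta.

   The Lipschitz bound follows from the Helmholtz equation and the rate of the
   far-field expansion alone. The demodulated solution
   g = exp (- i kappa |x|) psi satisfies
     Delta g = - 2 i kappa |x|^(- m) d_r (|x|^m g),   m = (d - 1) / 2.
   Averaging g along rays over |x| ~ rho, with a suitable weight, integrates the
   right-hand side exactly: the average is bounded, tends to a multiple of f1 on
   the sphere, and has a Laplacian bounded uniformly in rho, since |x|^m g
   changes by O(1 / rho) between rho and 2 rho. A gradient estimate for the
   Laplacian, by the maximum principle applied to the odd part across a
   hyperplane, then bounds its Lipschitz constant uniformly in rho. *)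

(** Without averaging, the gradient estimate is out of reach: the Laplacian of rho^m g(rho x) is
    rho^(m+2) times a radial derivative about whose size the far-field expansion says nothing. Only
    differences of |x|^m g along a ray are controlled, by O(1 / rho), hence the integration in a
    dilation parameter t. The dilation produces t^2 and the weight t^(m-2) leaves t^m, which makes
    the integrand an exact t-derivative. Finite Riemann sums stand for the integrals, so that the
    Laplacian is taken term by term; the number of nodes may depend on rho, since only the final
    bounds have to be uniform.

    The vector zeta is chosen so that (k, zeta) - kappa (theta, zeta) = alpha. As |y| = |x| +
    (theta, zeta) + O(1 / |x|), the argument of the sine in D tends to alpha. The exponent sigma is
    the smaller of 1, due to the far-field remainder and the change of direction, and (d - 1) / 2,
    due to the quadratic term |x|^m |psi_1|^2. *)

(** * Directional derivatives and one-variable calculus *)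

Section DirectionalDerivatives.
Context {R : realType}.

(** The difference quotients of [f \o s] along [v] and of [f] along [w] are the same function of
    [h], so no chain rule on [V] enters. *)
Lemma is_derive_affine (V W : normedModType R) (s : V -> W) (f : W -> R)
    (x v : V) (w : W) (df : R) :
  (forall h : R, s (h *: v + x) = h *: w + s x) ->
  is_derive (s x) w f df -> is_derive x v (f \o s) df.
Proof.
move=> sE [fx fv].
have E : (fun h : R => h^-1 *: (((f \o s) \o shift x) (h *: v) - (f \o s) x))
       = (fun h : R => h^-1 *: ((f \o shift (s x)) (h *: w) - f (s x))).
  by apply/funext => h /=; rewrite sE.
by split; [rewrite /derivable E|rewrite /derive E].
Qed.

Lemma is_derive_line (V : normedModType R) (f : V -> R) (p v : V) (t df : R) :
  is_derive (p + t *: v) v f df ->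
  is_derive t (1 : R) (fun s => f (p + s *: v)) df.
Proof.
apply: (@is_derive_affine _ V (fun s : R => p + s *: v)) => h /=.
rewrite scalerDl addrCA; congr (_ *: _ + _).
by rewrite /GRing.scale/= mulr1.
Qed.

(** With [is_derive_line], this moves directional derivatives to a real parameter and back, where
    the one-variable chain rule applies. *)
Lemma is_derive_unline (V : normedModType R) (f : V -> R) (x v : V) (df : R) :
  is_derive (0 : R) (1 : R) (fun h => f (x + h *: v)) df -> is_derive x v f df.
Proof.
move=> [f0 fv].
have E : (fun h : R => h^-1 *: ((f \o shift x) (h *: v) - f x)) =
   (fun h : R => h^-1 *: (((fun h => f (x + h *: v)) \o shift 0) (h *: 1) -
     f (x + 0 *: v))).
  apply/funext => h /=; rewrite scale0r !addr0.
  by rewrite [h%:A]mulr1 [x + _]addrC.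
by split; [rewrite /derivable E|rewrite /derive E].
Qed.

Lemma is_derive_compR (V : normedModType R) (phi : R -> R) (f : V -> R)
    (x v : V) (a b : R) :
  is_derive (f x) (1 : R) phi a -> is_derive x v f b ->
  is_derive x v (phi \o f) (a * b).
Proof.
move=> phia fb; apply: is_derive_unline.
apply: (@is_derive1_comp _ phi (fun h => f (x + h *: v))).
  by rewrite scale0r addr0.
by apply: is_derive_line; rewrite scale0r addr0.
Qed.

Lemma is_derive_scaledir (V : normedModType R) (f : V -> R) (x v : V) (k df : R) :
  is_derive x v f df -> is_derive x (k *: v) f (k * df).
Proof.
move=> fd; apply: is_derive_unline.
have -> : (fun h => f (x + h *: (k *: v))) =
          (fun h => f (x + h *: v)) \o (fun h : R => k * h).
  by apply/funext => h /=; rewrite scalerA mulrC.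
rewrite mulrC; apply: is_derive1_comp.
  by apply: is_derive_line; rewrite mulr0 scale0r addr0.
have := @is_deriveZ _ _ _ _ k _ _ _ (@is_derive_id _ _ (0 : R) (1 : R)).
by rewrite /GRing.scale/= mulr1.
Qed.

Lemma is_derive_continuous (f : R -> R) (t df : R) :
  is_derive t 1 f df -> {for t, continuous f}.
Proof. by move=> [/derivable1_diffP /differentiable_continuous]. Qed.

(** The endpoints come in either order because coordinate increments have no fixed sign. *)
Lemma MVT_sym (f df : R -> R) (a b : R) :
  (forall t, Num.min a b <= t <= Num.max a b -> is_derive t 1 f (df t)) ->
  exists2 c, Num.min a b <= c <= Num.max a b & f b - f a = df c * (b - a).
Proof.
wlog ab : a b / a <= b.
  move=> W H; case/orP: (le_total a b) => [/W|ba]; first exact.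
  have [|c cab fE] := W b a ba; first by rewrite minC maxC.
  exists c; first by rewrite minC maxC.
  by rewrite -opprB fE -mulrN opprB.
rewrite min_l// max_r// => H.
have [||c cab ->] := @MVT_segment R f df a b ab.
- by move=> x; rewrite in_itv/= => /andP[ax xb]; apply: H; rewrite !ltW.
- apply: continuous_in_subspaceT => x; rewrite inE/= in_itv/= => /H.
  exact: is_derive_continuous.
- by exists c.
Qed.

(** Fermat's rule gives h'(0) = 0. If c were positive, h' would be positive just to the right of 0,
    and the mean value theorem would make h exceed h(0) there. *)
Lemma second_derivative_at_max (h h' : R -> R) (a c : R) : 0 < a ->
  (forall t, `|t| < a -> is_derive t (1 : R) h (h' t)) ->
  is_derive (0 : R) (1 : R) h' c -> (forall t, `|t| < a -> h t <= h 0) -> c <= 0.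
Proof.
move=> a0 dh [dh'0 dh'c] hmax; rewrite leNgt; apply/negP => c0.
have h'00 : h' 0 = 0.
  have Na : - a <= a by rewrite ge0_cp// ltW.
  have [_ Dh0] : is_derive (0 : R) (1 : R) h 0.
    apply: (derive1_at_max Na).
    - by move=> t; rewrite in_itv/= -ltr_norml => /dh[].
    - by rewrite in_itv/= oppr_lt0 a0.
    - by move=> t; rewrite in_itv/= -ltr_norml => /hmax.
  by have [|_ <-] := dh 0; rewrite ?normr0.
have cv : h^-1 *: ((h' \o shift 0) (h *: 1) - h' 0) @[h --> (0 : R)^'] --> c.
  by move: dh'0; rewrite /derivable => /cvg_ex[l hl]; rewrite -dh'c /derive (cvg_lim _ hl).
have : \forall h \near (0 : R)^', 0 < h^-1 *: ((h' \o shift 0) (h *: 1) - h' 0).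
  exact: (cvgr_gt c).
rewrite near_withinE /= => /nbhs_ballP[e e0 He].
pose t0 := Num.min e a / 2.
have m0 : 0 < Num.min e a by rewrite lt_min e0.
have t00 : 0 < t0 by rewrite divr_gt0.
have t0m : t0 < Num.min e a by rewrite gtr_pMr// invf_lt1// ltr1n.
have pos t : 0 < t <= t0 -> 0 < h' t.
  move=> /andP[t_gt0 tt0].
  have := He t; rewrite /ball/= sub0r normrN gtr0_norm//.
  have te : t < e by rewrite (le_lt_trans tt0)// (lt_le_trans t0m)// ge_min lexx.
  move=> /(_ te (lt0r_neq0 t_gt0)).
  by rewrite h'00 subr0 addr0 /GRing.scale/= mulr1 pmulr_rgt0// invr_gt0.
have t0a : t0 < a by rewrite (lt_le_trans t0m)// ge_min lexx orbT.
have [||u u0 hE] := @MVT R h h' 0 t0 t00.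
- move=> x; rewrite in_itv/= => /andP[x0 xt]; apply: dh.
  by rewrite gtr0_norm// (lt_trans xt).
- apply: continuous_in_subspaceT => x; rewrite inE/= in_itv/= => /andP[x0 xt].
  by apply: is_derive_continuous (dh _ _); rewrite ger0_norm// (le_lt_trans xt).
- have : h t0 <= h 0 by apply: hmax; rewrite gtr0_norm.
  rewrite -subr_le0 hE subr0 leNgt => /negP; apply; apply: mulr_gt0 => //.
  by apply: pos; move: u0; rewrite in_itv/= => /andP[-> /ltW].
Qed.

End DirectionalDerivatives.

(** * The Laplacian along coordinate lines and the maximum principle *)

Section MaximumPrinciple.
Context {R : realType} {d : nat}.
Implicit Types (x z p c : 'rV[R]_d) (O K B : set 'rV[R]_d) (u L : 'rV[R]_d -> R).

Lemma base_coord i j : (base i : 'rV[R]_d) 0 j = (i == j)%:R.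
Proof. by rewrite mxE eqxx /= eq_sym. Qed.

Lemma is_derive_coord x (v : 'rV[R]_d) i : is_derive x v (fun z => z 0 i) (v 0 i).
Proof.
apply: is_derive_unline.
have -> : (fun h : R => (x + h *: v) 0 i) = (fun h => x 0 i + h * v 0 i).
  by apply/funext => h; rewrite !mxE.
apply: is_derive_eq.
by rewrite add0r mul1r scaler0 add0r [LHS]mulr1.
Qed.

Lemma line_continuous (V : normedModType R) (a v : V) :
  continuous (fun t : R => a + t *: v).
Proof.
move=> t; apply: cvgD; first exact: cvg_cst.
by apply: cvgZr_tmp; exact: cvg_id.
Qed.

(** Only the pure second derivatives along coordinate lines are recorded. This is what the maximum
    principle uses, and it passes to sums, dilations and reflections. *)
Definition has_laplacian O u L : Prop :=
  exists D1 D2 : 'I_d -> 'rV[R]_d -> R, forall x, O x ->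
    [/\ forall i, is_derive x (base i) u (D1 i x),
        forall i, is_derive x (base i) (D1 i) (D2 i x)
      & L x = \sum_i D2 i x].

Lemma has_laplacianW O B u L : O `<=` B -> has_laplacian B u L ->
  has_laplacian O u L.
Proof. by move=> OB [D1 [D2 H]]; exists D1, D2 => x /OB; exact: H. Qed.

Lemma has_laplacianN O u L :
  has_laplacian O u L -> has_laplacian O (fun x => - u x) (fun x => - L x).
Proof.
move=> [D1 [D2 H]].
exists (fun i x => - D1 i x), (fun i x => - D2 i x) => x /H[H1 H2 ->].
by split=> [i|i|]; [exact: is_deriveN|exact: is_deriveN|rewrite sumrN].
Qed.

Lemma has_laplacianB O u1 u2 L1 L2 :
  has_laplacian O u1 L1 -> has_laplacian O u2 L2 ->
  has_laplacian O (fun x => u1 x - u2 x) (fun x => L1 x - L2 x).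
Proof.
move=> [D1 [D2 H]] [E1 [E2 G]].
exists (fun i x => D1 i x - E1 i x), (fun i x => D2 i x - E2 i x) => x Ox.
have [H1 H2 ->] := H x Ox; have [G1 G2 ->] := G x Ox.
by split=> [i|i|]; [exact: is_deriveB|exact: is_deriveB|rewrite sumrB].
Qed.

Lemma has_laplacian_separable O (phi phi' phi'' : 'I_d -> R -> R) :
  (forall i (t : R), is_derive t (1 : R) (phi i) (phi' i t)) ->
  (forall i (t : R), is_derive t (1 : R) (phi' i) (phi'' i t)) ->
  has_laplacian O (fun x => \sum_i phi i (x 0 i))
                  (fun x => \sum_i phi'' i (x 0 i)).
Proof.
move=> H1 H2.
exists (fun i x => phi' i (x 0 i)), (fun i x => phi'' i (x 0 i)) => x _.
have coordD k (i : 'I_d) (f f' : R -> R) : (forall t : R, is_derive t (1 : R) f (f' t)) ->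
    is_derive x (base i) (fun z => f (z 0 k)) (f' (x 0 k) * (i == k)%:R).
  move=> ff'; apply: (@is_derive_compR _ _ f (fun z => z 0 k)) => //.
  by rewrite -base_coord; exact: is_derive_coord.
split=> // i; last by have := coordD i i _ _ (H2 i); rewrite eqxx mulr1.
have := @is_derive_sum _ _ _ _ (fun k z => phi k (z 0 k)) x (base i) _
  (fun k => coordD k i _ _ (H1 k)).
have -> : \sum_(k < d) (fun z : 'rV[R]_d => phi k (z 0 k)) =
          (fun z => \sum_i phi i (z 0 i)).
  by apply/funext => z; rewrite fct_sumE.
rewrite (bigD1 i)//= eqxx mulr1 big1 ?addr0// => k /negPf ki.
by rewrite eq_sym ki mulr0.
Qed.

(** A positive maximum over [K] would lie in [O]; there every pure second derivative is at most 0,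
    against [L > 0]. The strict sign spares the usual perturbation argument. *)
Lemma max_principle K O u L : compact K -> {within K, continuous u} ->
  open O -> O `<=` K -> has_laplacian O u L -> (forall x, O x -> 0 < L x) ->
  (forall x, K x -> ~ O x -> u x <= 0) -> forall x, K x -> u x <= 0.
Proof.
move=> cK cu oO OK [D1 [D2 HL]] L0 bd x Kx.
have [|c cinK cmax] := @compact_EVT_max _ _ u K _ cK cu; first by exists x.
have Kc : K c by rewrite inE in cinK.
apply: (@le_trans _ _ (u c)); first by apply: cmax; rewrite inE.
rewrite leNgt; apply/negP => uc0.
have Oc : O c by apply: contrapT => /(bd _ Kc); rewrite leNgt uc0.
have [_ _ Lc] := HL _ Oc.
have := L0 _ Oc; rewrite Lc ltNge => /negP; apply.
apply: sumr_le0 => i _.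
have : nbhs (0 : R) [set t : R | O (c + t *: base i)].
  apply: (@line_continuous 'rV[R]_d c (base i) 0).
  by rewrite scale0r addr0; exact: open_nbhs_nbhs.
move=> /nbhs_ballP[a /= a0 Ha].
have {}Ha t : `|t| < a -> O (c + t *: base i).
  by move=> ta; apply: Ha; rewrite /ball/= sub0r normrN.
apply: (@second_derivative_at_max _ (fun t => u (c + t *: base i))
  (fun t => D1 i (c + t *: base i)) _ _ a0).
- by move=> t /Ha /HL[H1 _ _]; exact: is_derive_line.
- have [_ H2 _] := HL _ Oc.
  by apply: is_derive_line; rewrite scale0r addr0.
- by move=> t /Ha /OK Kt; rewrite scale0r addr0; apply: cmax; rewrite inE.
Qed.

Definition reflect_coord p j z : 'rV[R]_d :=
  z - (2 * (z 0 j - p 0 j)) *: base j.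

Lemma reflect_coordE p j z i : reflect_coord p j z 0 i - p 0 i =
  if i == j then - (z 0 i - p 0 i) else z 0 i - p 0 i.
Proof.
rewrite !mxE eqxx /=; case: eqP => [->|_]; last by rewrite mulr0 subr0.
by rewrite mulr1; ring.
Qed.

(** The reflection flips the sign of the [j]-th first derivative only, and in the second derivative
    this sign occurs twice. *)
Lemma has_laplacian_reflect O u L p j : has_laplacian O u L ->
  has_laplacian [set z | O (reflect_coord p j z)]
    (u \o reflect_coord p j) (L \o reflect_coord p j).
Proof.
move=> [D1 [D2 H]]; pose s i : R := if i == j then -1 else 1.
have ss i : s i * s i = 1 by rewrite /s; case: eqP; rewrite ?mulrNN ?mulr1.
have dr i z h : reflect_coord p j (h *: base i + z) =
    h *: (s i *: base i) + reflect_coord p j z.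
  apply/rowP => k; rewrite !mxE !eqxx /= /s.
  by case: (eqVneq i j) => [->|_] /=; ring.
exists (fun i => s i \*: (D1 i \o reflect_coord p j)),
       (fun i => D2 i \o reflect_coord p j) => x /H[H1 H2 LE]; split => // i.
- by apply: is_derive_affine (dr i x) _; exact: is_derive_scaledir.
- have := @is_deriveZ _ _ _ _ (s i) _ _ _
    (is_derive_affine (dr i x) (is_derive_scaledir (s i) (H2 i))).
  by rewrite /GRing.scale/= mulrA ss mul1r.
Qed.

End MaximumPrinciple.

Lemma continuous_sum (R : realType) (T : topologicalType) (n : nat)
    (f : 'I_n -> T -> R) (x : T) :
  (forall i, {for x, continuous (f i)}) ->
  {for x, continuous (fun y => \sum_i f i y)}.
Proof.
move=> cf.
have -> : (fun y => \sum_i f i y) = \sum_i f i.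
  by apply/funext => y; rewrite fct_sumE.
elim/big_ind: _ => [|g h cg ch|i _]; [exact: cvg_cst| |exact: cf].
exact: continuousD.
Qed.

(** * Bound on the odd part of a function by a barrier *)

Section GradientEstimate.
Context {R : realType} {d : nat}.
Implicit Types (x z p c : 'rV[R]_d) (B : set 'rV[R]_d) (u L : 'rV[R]_d -> R).

Lemma compact_box (lo hi : 'I_d -> R) :
  compact [set z : 'rV[R]_d | forall i, lo i <= z 0 i <= hi i].
Proof.
have := @rV_compact R d (fun i => `[lo i, hi i]%classic)
  (fun i => @segment_compact _ _ _).
by congr compact; apply/seteqP; split=> z /= zb i; have := zb i; rewrite /= in_itv.
Qed.

Lemma open_box (lo hi : 'I_d -> R) :
  open [set z : 'rV[R]_d | forall i, lo i < z 0 i < hi i].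
Proof.
rewrite openE => z zb; rewrite /interior.
suff : forall i, \forall w \near z, lo i < (w : 'rV[R]_d) 0 i < hi i.
  by move=> H; exact: (@filter_forall _ _ _ (nbhs z) _ H).
move=> i; have /andP[l h] := zb i.
have cz : {for z, continuous (fun w : 'rV[R]_d => w 0 i : R)}.
  exact: coord_continuous.
near=> w; apply/andP; split; near: w.
- exact: (cvgr_gt _ cz).
- exact: (cvgr_lt _ cz).
Unshelve. all: by end_near. Qed.

Definition box c (r : R) : set 'rV[R]_d := [set z | forall i, `|z 0 i - c 0 i| <= r].

Lemma reflect_coord_continuous p j : continuous (reflect_coord p j).
Proof.
move=> z; pose g (w : 'rV[R]_d) : R := 2 * (w 0 j - p 0 j).
have cg : {for z, continuous g}.
  apply: (@continuousM _ _ (fun=> 2) (fun w : 'rV[R]_d => w 0 j - p 0 j)).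
    exact: cst_continuous.
  apply: (@continuousB _ _ _ (fun w : 'rV[R]_d => w 0 j) (fun=> p 0 j)).
    exact: coord_continuous.
  exact: cst_continuous.
apply: (@continuousB _ 'rV[R]_d _ id (fun w => g w *: base j)).
  exact: cvg_id.
have ct : {for g z, continuous (fun t : R => t *: (base j : 'rV[R]_d))}.
  by apply: cvgZr_tmp; exact: cvg_id.
exact: (@continuous_comp _ _ _ g (fun t : R => t *: base j) z cg ct).
Qed.

(* The odd part of u across the hyperplane through p orthogonal to base j
   vanishes there; it is compared on the half box with the barrier
   \sum_i phi i, whose Laplacian is less than - 2 M. *)
Lemma odd_part_le B u L (M r : R) p j t : 0 <= M -> 0 < r ->
  has_laplacian B u L -> (forall z, B z -> {for z, continuous u}) ->
  box p r `<=` B ->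
  (forall z, B z -> `|u z| <= M) -> (forall z, B z -> `|L z| <= M) ->
  0 <= t <= r ->
  u (p + t *: base j) - u (p - t *: base j) <=
    ((2 * M / r ^+ 2 * d%:R + M + 1) * r + 2 * M / r) * t.
Proof.
move=> M0 r0 hL cu boxB uM LM /andP[t0 tr].
(* The odd part is at most 2M in size, and so is the odd part of the Laplacian. [K0] makes one
   barrier term equal to 2M on each side face. [b] brings the Laplacian of the barrier to - 2 K0 - 2
   M - 2, strictly below - 2 M. [a] gives a r - b r^2 = 2 M on the far face, and a >= b r keeps the
   [j]-th term nonnegative. *)
pose K0 := 2 * M / r ^+ 2.
have K00 : 0 <= K0 by rewrite divr_ge0 ?mulr_ge0 ?exprn_ge0// ltW.
pose b := K0 * d%:R + M + 1.
have b0 : 0 <= b by rewrite !addr_ge0// mulr_ge0.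
pose a := b * r + 2 * M / r.
have Mr0 : 0 <= 2 * M / r by rewrite divr_ge0 ?mulr_ge0// ltW.
pose phi i y := if i == j then a * (y - p 0 j) - b * (y - p 0 j) ^+ 2
                else K0 * (y - p 0 i) ^+ 2.
pose phi' i y := if i == j then a - 2 * b * (y - p 0 j)
                else 2 * K0 * (y - p 0 i).
pose phi'' i (y : R) : R := if i == j then - (2 * b) else 2 * K0.
have dphi i (y : R) : is_derive y (1 : R) (phi i) (phi' i y).
  rewrite /phi /phi'; case: eqP => _; apply: is_derive_eq;
    rewrite /GRing.scale/=; ring.
have dphi' i (y : R) : is_derive y (1 : R) (phi' i) (phi'' i y).
  rewrite /phi' /phi''; case: eqP => _; apply: is_derive_eq;
    rewrite /GRing.scale/=; ring.
pose lo i := if i == j then p 0 i else p 0 i - r.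
pose hi i := p 0 i + r.
pose K := [set z : 'rV[R]_d | forall i, lo i <= z 0 i <= hi i].
pose O := [set z : 'rV[R]_d | forall i, lo i < z 0 i < hi i].
have OK : O `<=` K by move=> z Oz i; have /andP[/ltW -> /ltW ->] := Oz i.
have Kbox z : K z -> box p r z.
  move=> Kz i; have := Kz i; rewrite /lo /hi ler_distl => /andP[l ->].
  rewrite andbT; move: l; case: eqP => // _; apply: le_trans.
  by rewrite lerBlDr lerDl ltW.
have Krefl z : K z -> box p r (reflect_coord p j z).
  by move=> /Kbox Kz i; rewrite reflect_coordE; case: eqP => _; rewrite ?normrN; exact: Kz.
pose W z := \sum_i phi i (z 0 i).
pose v z := u z - u (reflect_coord p j z) - W z.
have hv : has_laplacian O v
    (fun z => L z - L (reflect_coord p j z) - \sum_i phi'' i (z 0 i)).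
  apply: has_laplacianB; last exact: has_laplacian_separable.
  apply: has_laplacianB; first by apply: has_laplacianW hL => z /OK/Kbox/boxB.
  by apply: has_laplacianW (has_laplacian_reflect p j hL) => z /OK/Krefl/boxB.
have cv : {within K, continuous v}.
  apply: continuous_in_subspaceT => z; rewrite inE => Kz.
  apply: (@continuousB _ _ _ (fun z => u z - u (reflect_coord p j z)) W).
    apply: (@continuousB _ _ _ u (u \o reflect_coord p j)).
      exact/cu/boxB/Kbox.
    apply: continuous_comp; first exact: reflect_coord_continuous.
    exact/cu/boxB/Krefl.
  apply: continuous_sum => i.
  apply: (@continuous_comp _ _ _ (fun z : 'rV[R]_d => z 0 i : R)).
    exact: coord_continuous.
  exact: is_derive_continuous (dphi i _).
have phij z : phi j (z 0 j) = a * (z 0 j - p 0 j) - b * (z 0 j - p 0 j) ^+ 2.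
  by rewrite /phi eqxx.
have phi0 z i : K z -> 0 <= phi i (z 0 i).
  move=> Kz; rewrite /phi; case: eqP => [->|_]; last by rewrite mulr_ge0// sqr_ge0.
  have := Kz j; rewrite /lo /hi eqxx => /andP[l h].
  have l' : 0 <= z 0 j - p 0 j by rewrite subr_ge0.
  rewrite expr2 mulrA -mulrBl mulr_ge0// subr_ge0.
  have br : b * r <= a by rewrite lerDl.
  by apply: le_trans br; rewrite ler_wpM2l// lerBlDl.
have key : forall z, K z -> v z <= 0.
  apply: (max_principle (@compact_box lo hi) cv (@open_box lo hi) OK hv).
  - move=> z /OK Kz.
    have := LM _ (boxB _ (Kbox _ Kz)); have := LM _ (boxB _ (Krefl _ Kz)).
    rewrite !ler_norml => /andP[l1 l2] /andP[l3 l4].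
    have S : \sum_i phi'' i (z 0 i) = 2 * K0 * (d%:R - 1) - 2 * b.
      have -> : 2 * K0 * (d%:R - 1) - 2 * b =
          \sum_(i < d) (2 * K0 + if i == j then - (2 * b) - 2 * K0 else 0).
        rewrite big_split/= -big_mkcond/= big_pred1_eq sumr_const card_ord.
        by rewrite -mulr_natr; ring.
      by apply: eq_bigr => i _; rewrite /phi''; case: eqP => _; ring.
    rewrite S /b; lra.
  (* On a side face or on the far face a single barrier term already reaches 2M ([big]); on the
     mirror hyperplane the odd part vanishes and the barrier is nonnegative. *)
  - move=> z Kz nOz; rewrite /v.
    have [i zi] : exists i, ~ (lo i < z 0 i < hi i).
      by apply/existsNP.
    have [uz uz'] := (uM _ (boxB _ (Kbox _ Kz)), uM _ (boxB _ (Krefl _ Kz))).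
    move: uz uz'; rewrite !ler_norml => /andP[l1 l2] /andP[l3 l4].
    have phiW k : phi k (z 0 k) <= W z.
      by rewrite /W (bigD1 k)//= lerDl sumr_ge0// => i' _; exact: phi0.
    have big : 2 * M <= phi i (z 0 i) -> u z - u (reflect_coord p j z) - W z <= 0.
      by move=> H; have := phiW i; lra.
    have /andP[lz hz] := Kz i.
    have [ij|ij] := eqVneq i j; last first.
      apply: big; rewrite /phi (negPf ij).
      have -> : (z 0 i - p 0 i) ^+ 2 = r ^+ 2.
        move: zi lz hz; rewrite /lo /hi (negPf ij) => /negP.
        rewrite negb_and -!leNgt => /orP[z1 z2 _|z1 _ z2].
          have -> : z 0 i = p 0 i - r by apply/eqP; rewrite eq_le z1.
          by rewrite addrAC subrr sub0r sqrrN.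
        have -> : z 0 i = p 0 i + r by apply/eqP; rewrite eq_le z1 z2.
        by rewrite addrAC subrr add0r.
      by rewrite /K0 divfK// expf_neq0// lt0r_neq0.
    subst i; move: zi lz hz; rewrite /lo /hi eqxx => /negP.
    rewrite negb_and -!leNgt => /orP[z1 z2 _|z1 _ z2].
      have zj : z 0 j = p 0 j by apply/eqP; rewrite eq_le z1.
      have -> : reflect_coord p j z = z.
        by rewrite /reflect_coord zj subrr mulr0 scale0r subr0.
      by rewrite subrr sub0r oppr_le0 (le_trans (phi0 z j Kz)).
    apply: big; rewrite phij.
    have -> : z 0 j = p 0 j + r by apply/eqP; rewrite eq_le z1 z2.
    have -> : p 0 j + r - p 0 j = r by rewrite addrAC subrr add0r.
    suff -> : a * r - b * r ^+ 2 = 2 * M by [].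
    by rewrite /a; field; rewrite lt0r_neq0.
pose z := p + t *: base j : 'rV[R]_d.
have zE i : z 0 i = p 0 i + t * (j == i)%:R by rewrite !mxE eqxx /= [i == j]eq_sym.
have Kz : K z.
  move=> i; rewrite zE /lo /hi [i == j]eq_sym; case: eqP => [_|_] /=.
    by rewrite mulr1 lerDl t0 lerD2l.
  by rewrite mulr0 addr0 lerBlDr lerDl ltW.
have := key z Kz; rewrite /v.
have -> : reflect_coord p j z = p - t *: base j.
  by apply/rowP => i; rewrite /reflect_coord /z !mxE !eqxx /=; ring.
have -> : W z = a * t - b * t ^+ 2.
  rewrite /W (bigD1 j)//= big1 ?addr0.
    by rewrite phij zE eqxx mulr1 addrAC subrr add0r.
  move=> i ij; rewrite /phi (negPf ij) zE eq_sym (negPf ij) mulr0 addr0.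
  by rewrite subrr expr0n/= mulr0.
rewrite subr_le0 => /le_trans; apply.
by rewrite gerBl mulr_ge0// sqr_ge0.
Qed.

End GradientEstimate.

(** * Paths along the axes: Lipschitz bound and radial differentiability *)

Section CoordinatePath.
Context {R : realType} {d : nat}.
Implicit Types (x z p c v : 'rV[R]_d) (B O : set 'rV[R]_d) (u L f : 'rV[R]_d -> R).

(** The [k]-th corner of the path from [z] to [x] that changes one coordinate at a time. The path
    stays in every sup-norm box containing both ends, which is why boxes are used instead of
    Euclidean balls. *)
Definition mix k x z : 'rV[R]_d :=
  \row_i (if (i < k)%N then x 0 i else z 0 i).

Lemma mix_step (k : 'I_d) x z :
  mix k.+1 x z = mix k x z + (x 0 k - z 0 k) *: base k.
Proof.
apply/rowP => i; rewrite !mxE eqxx /= ltnS.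
have [->|ik] := eqVneq i k; first by rewrite leqnn ltnn mulr1; ring.
by rewrite mulr0 addr0 ltn_neqAle ik.
Qed.

Lemma mix_telescope f x z :
  f x - f z = \sum_(k < d) (f (mix k.+1 x z) - f (mix k x z)).
Proof.
have <- : mix d x z = x by apply/rowP => i; rewrite mxE ltn_ord.
have {2}<- : mix 0 x z = z by apply/rowP => i; rewrite mxE.
rewrite -(big_mkord xpredT (fun k => f (mix k.+1 _ _) - f (mix k _ _))).
rewrite telescope_sumr//.
have mixd a b : mix d (mix d a b) b = mix d a b.
  by apply/rowP => i; rewrite !mxE ltn_ord.
have mix0 a b : mix 0 (mix d a b) b = mix 0 a b.
  by apply/rowP => i; rewrite !mxE.
by rewrite mixd mix0.
Qed.

Lemma mix_box c r k x z : box c r x -> box c r z -> box c r (mix k x z).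
Proof. by move=> bx bz i; rewrite mxE; case: ifP. Qed.

Lemma box_center c r : 0 <= r -> box c r c.
Proof. by move=> r0 i; rewrite subrr normr0. Qed.

Lemma box_segment c r q k (s t : R) : box c r q -> box c r (q + s *: base k) ->
  Num.min 0 s <= t <= Num.max 0 s -> box c r (q + t *: base k).
Proof.
move=> bq bs tI i; have := bq i; have := bs i; rewrite !mxE eqxx /=.
case: (i == k); rewrite ?mulr0 ?addr0// !mulr1 !ler_norml.
move: tI; case: (leP 0 s) => _ /andP[t1 t2] /andP[s1 s2] /andP[q1 q2]; lra.
Qed.

Lemma nbhs_box x (N : set 'rV[R]_d) : nbhs x N -> exists2 r : R, 0 < r & box x r `<=` N.
Proof.
move=> /nbhs_ballP[e /= e0 eN]; exists (e / 2); first by rewrite divr_gt0.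
move=> z bz; apply: eN; rewrite mx_norm_ball /ball_ /=.
rewrite /Num.norm/= mx_normrE; apply: bigmax_lt => //= -[i j] _ /=.
by rewrite ord1 !mxE distrC (le_lt_trans (bz j))// gtr_pMr// invf_lt1// ltr1n.
Qed.

(** The slope in [odd_part_le]. It depends on the function only through [M], hence the uniformity in
    rho later on. *)
Definition lip_const (M r : R) : R :=
  (2 * M / r ^+ 2 * d%:R + M + 1) * r + 2 * M / r.

Lemma lip_const_ge0 (M r : R) : 0 <= M -> 0 < r -> 0 <= lip_const M r.
Proof.
move=> M0 /ltW r0.
by rewrite /lip_const !(addr_ge0, divr_ge0, mulr_ge0, exprn_ge0).
Qed.

(** The ends of each leg of the coordinate path are mirror images across the hyperplane through its
    midpoint [p], so [odd_part_le] at [p], for [u] and for [- u], bounds the increment. As [p] lies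
    in [box c r] and needs a box of size [r] around it, [box c (r + r)] is required. *)
Lemma laplacian_lipschitz B u L (M r : R) c : 0 <= M -> 0 < r ->
  has_laplacian B u L -> (forall z, B z -> {for z, continuous u}) ->
  box c (r + r) `<=` B ->
  (forall z, B z -> `|u z| <= M) -> (forall z, B z -> `|L z| <= M) ->
  forall x, box c r x ->
  `|u x - u c| <= lip_const M r * \sum_i `|x 0 i - c 0 i|.
Proof.
move=> M0 r0 hL cu boxB uM LM x bx; rewrite mix_telescope mulr_sumr.
apply: (le_trans (ler_norm_sum _ _ _)); apply: ler_sum => k _.
rewrite mix_step; set q := mix k x c; set s := x 0 k - c 0 k.
have bc := box_center c (ltW r0).
have bq : box c r q by exact: mix_box.
have bqs : box c r (q + s *: base k) by rewrite -mix_step; exact: mix_box.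
pose p := q + (s / 2) *: base k.
have bp : box c r p.
  apply: (box_segment bq bqs); rewrite /Num.min /Num.max; case: ltP => s0; lra.
have pB : box p r `<=` B.
  move=> z bz; apply: boxB => i.
  have -> : z 0 i - c 0 i = (z 0 i - p 0 i) + (p 0 i - c 0 i) by ring.
  by rewrite (le_trans (ler_normD _ _))// lerD.
have st0 : 0 <= `|s| / 2 <= r.
  rewrite divr_ge0//=; apply: (@le_trans _ _ `|s|); last exact: bx.
  by rewrite ler_piMr// invf_le1// ler1n.
have ineq w K : has_laplacian B w K -> (forall z, B z -> {for z, continuous w}) ->
    (forall z, B z -> `|w z| <= M) -> (forall z, B z -> `|K z| <= M) ->
    w (p + (`|s| / 2) *: base k) - w (p - (`|s| / 2) *: base k) <=
    lip_const M r * `|s|.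
  move=> hw cw wM KM.
  have H := odd_part_le k M0 r0 hw cw pB wM KM st0; apply: (le_trans H).
  rewrite ler_wpM2l//; first exact: lip_const_ge0.
  by rewrite ler_piMr// invf_le1// ler1n.
have i1 := ineq _ _ hL cu uM LM.
have i2 : - u (p + (`|s| / 2) *: base k) + u (p - (`|s| / 2) *: base k) <=
    lip_const M r * `|s|.
  rewrite -[X in _ + X]opprK; apply: (ineq _ _ (has_laplacianN hL)).
  - by move=> z /cu; exact: continuousN.
  - by move=> z /uM; rewrite normrN.
  - by move=> z /LM; rewrite normrN.
have p1 : p + (s / 2) *: base k = q + s *: base k.
  by apply/rowP => i; rewrite !mxE; field.
have p2 : p - (s / 2) *: base k = q.
  by apply/rowP => i; rewrite !mxE; ring.
move: i1 i2; rewrite ler_norml; case: (ler0P s) => s0.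
  rewrite mulNr scaleNr opprK p1 p2; lra.
rewrite p1 p2; lra.
Qed.

(** The mean value theorem on each leg of the coordinate path, with continuity of the partial
    derivatives at [x]. It yields radial derivatives from partial ones. *)
Lemma is_derive_C1 O f (D : 'I_d -> 'rV[R]_d -> R) x v :
  nbhs x O -> (forall i z, O z -> is_derive z (base i) f (D i z)) ->
  (forall i, {for x, continuous (D i)}) ->
  is_derive x v f (\sum_i v 0 i * D i x).
Proof.
move=> xO dD cD.
suff cv : h^-1 *: ((f \o shift x) (h *: v) - f x) @[h --> (0 : R)^'] -->
    \sum_i v 0 i * D i x.
  split; first by apply/cvg_ex; exists (\sum_i v 0 i * D i x).
  exact: (cvg_lim _ cv).
apply/cvgrPdist_le => e e0.
(* The summand 1 keeps the divisions by [V] meaningful when [v] is 0. *)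
pose V := 1 + \sum_i `|v 0 i|.
have Vi i : `|v 0 i| <= V.
  by rewrite /V (bigD1 i)//= addrCA lerDl addr_ge0// sumr_ge0.
have V0 : 0 < V by rewrite ltr_pwDl// sumr_ge0.
have : \forall z \near x, O z /\ forall i, `|D i x - D i z| <= e / V.
  near=> z; split; first by near: z.
  near: z; apply: (@filter_forall _ _ _ (nbhs x) _) => i.
  by have /cvgrPdist_le := cD i; apply; rewrite divr_gt0.
move=> /nbhs_box[r r0 bN].
rewrite near_withinE; apply/nbhs_ballP; exists (r / V) => [|h hb h0 /=].
  exact: divr_gt0.
have hV i : `|h * v 0 i| <= r.
  rewrite normrM (le_trans (ler_wpM2l (normr_ge0 h) (Vi i)))//.
  by move: hb; rewrite /ball/= sub0r normrN -ler_pdivlMr// => /ltW.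
pose y := h *: v + x.
have yi i : y 0 i - x 0 i = h * v 0 i by rewrite !mxE addrK.
have by_ : box x r y by move=> i; rewrite yi.
have bx := box_center x (ltW r0).
have step (k : 'I_d) : exists2 xi, box x r xi &
    f (mix k.+1 y x) - f (mix k y x) = D k xi * (h * v 0 k).
  have bs := mix_box k.+1 by_ bx; move: (bs); rewrite mix_step yi => bs'.
  have [|t tI fE] := @MVT_sym _ (fun t => f (mix k y x + t *: base k))
     (fun t => D k (mix k y x + t *: base k)) 0 (h * v 0 k).
    move=> t tI; apply: is_derive_line; apply: dD.
    by have [] := bN _ (box_segment (mix_box k by_ bx) bs' tI).
  exists (mix k y x + t *: base k).
    exact: box_segment (mix_box k by_ bx) bs' tI.
  by move: fE; rewrite scale0r addr0 subr0.
rewrite -/y mix_telescope scaler_sumr -sumrB.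
apply: (le_trans (ler_norm_sum _ _ _)).
have -> : e = e / V * V by rewrite divfK// lt0r_neq0.
apply: (@le_trans _ _ (\sum_i e / V * `|v 0 i|)); last first.
  by rewrite -mulr_sumr ler_wpM2l ?divr_ge0 ?ltW// /V ltrDr.
apply: ler_sum => k _; have [xi /bN[_ Dxi] ->] := step k.
have -> : v 0 k * D k x - h^-1 *: (D k xi * (h * v 0 k)) =
    (D k x - D k xi) * v 0 k.
  by rewrite /GRing.scale/=; field.
by rewrite normrM ler_wpM2r.
Unshelve. all: by end_near. Qed.

End CoordinatePath.

(** * The Euclidean norm and its derivatives *)

Section Euclidean.
Context {R : realType} {d : nat}.
Implicit Types (x y z v : 'rV[R]_d).

Lemma dot_ge0 x : 0 <= dot x x.
Proof. by apply: sumr_ge0 => i _; rewrite -expr2 sqr_ge0. Qed.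

Lemma enorm_ge0 x : 0 <= enorm x.
Proof. exact: sqrtr_ge0. Qed.

Lemma sqr_enorm x : enorm x ^+ 2 = dot x x.
Proof. by rewrite sqr_sqrtr// dot_ge0. Qed.

Lemma dotC x y : dot x y = dot y x.
Proof. by apply: eq_bigr => i _; rewrite mulrC. Qed.

Lemma dotDl x y z : dot (x + y) z = dot x z + dot y z.
Proof. by rewrite -big_split; apply: eq_bigr => i _; rewrite mxE mulrDl. Qed.

Lemma dotZl (a : R) x y : dot (a *: x) y = a * dot x y.
Proof. by rewrite mulr_sumr; apply: eq_bigr => i _; rewrite mxE mulrA. Qed.

Lemma dotDr x y z : dot x (y + z) = dot x y + dot x z.
Proof. by rewrite dotC dotDl !(dotC x). Qed.

Lemma dotZr (a : R) x y : dot x (a *: y) = a * dot x y.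
Proof. by rewrite dotC dotZl dotC. Qed.

Lemma dot_base x i : dot x (base i) = x 0 i.
Proof.
rewrite /dot (bigD1 i)//= base_coord eqxx mulr1 big1 ?addr0// => j ji.
by rewrite base_coord eq_sym (negPf ji) mulr0.
Qed.

Lemma enormZ (a : R) x : enorm (a *: x) = `|a| * enorm x.
Proof.
by rewrite /enorm dotZl dotZr mulrA -expr2 sqrtrM ?sqr_ge0// sqrtr_sqr.
Qed.

Lemma coord_le_enorm x i : `|x 0 i| <= enorm x.
Proof.
rewrite -(@ler_pXn2r _ 2)// ?nnegrE ?enorm_ge0// sqr_enorm /dot real_normK ?num_real//.
by rewrite (bigD1 i)//= -expr2 lerDl sumr_ge0// => j _; rewrite -expr2 sqr_ge0.
Qed.

Lemma enorm_continuous : continuous (enorm : 'rV[R]_d -> R).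
Proof.
move=> x; apply: (@continuous_comp _ _ _ (fun x => dot x x) (@Num.sqrt R)).
  apply: continuous_sum => i.
  apply: (@continuousM _ _ (fun w : 'rV[R]_d => w 0 i) (fun w : 'rV[R]_d => w 0 i));
    exact: coord_continuous.
exact: sqrt_continuous.
Qed.

Lemma is_derive_enorm x v : 0 < enorm x ->
  is_derive x v (enorm : 'rV[R]_d -> R) (dot x v / enorm x).
Proof.
move=> x0; have dd : is_derive x v (fun x => dot x x) (2 * dot x v).
  have := @is_derive_sum _ _ _ _ _ x v _ (fun i =>
    @is_deriveM _ _ _ _ _ _ _ _ (is_derive_coord x v i) (is_derive_coord x v i)).
  have -> : \sum_(i < d) ((fun z : 'rV[R]_d => z 0 i : R) *
      (fun z : 'rV[R]_d => z 0 i : R)) = (fun x => dot x x).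
    by apply/funext => z; rewrite fct_sumE.
  congr is_derive; rewrite /dot mulr_sumr; apply: eq_bigr => i _.
  by rewrite /GRing.scale/=; ring.
have dx0 : 0 < dot x x by rewrite -sqr_enorm exprn_gt0.
have := @is_derive_compR _ _ _ (fun x => dot x x) _ _ _ _ (is_derive1_sqrt dx0) dd.
rewrite -/(enorm x); congr is_derive.
by field; rewrite lt0r_neq0.
Qed.

Definition radial i x : R := x 0 i / enorm x.

Lemma sum_radial_sqr x : 0 < enorm x -> \sum_i radial i x ^+ 2 = 1.
Proof.
move=> x0; rewrite /radial; under eq_bigr do rewrite exprMn expr2 exprVn.
by rewrite -mulr_suml sqr_enorm -/(dot x x) divff// -sqr_enorm expf_neq0// lt0r_neq0.
Qed.

Definition dradial i x : R := (1 - radial i x ^+ 2) / enorm x.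

Lemma is_derive_radial i x : 0 < enorm x ->
  is_derive x (base i) (radial i) (dradial i x).
Proof.
move=> x0.
have dN := is_derive_enorm (base i) x0.
have dV : is_derive x (base i) (fun x => (enorm x)^-1)
    (- enorm x ^- 2 * (dot x (base i) / enorm x)).
  apply: (is_derive_compR _ dN).
  have := @is_deriveV R id (enorm x) 1 1 (lt0r_neq0 x0) (is_derive_id _ _).
  by rewrite /GRing.scale/= mulr1.
have := is_deriveM (is_derive_coord x (base i) i) dV.
congr is_derive; rewrite base_coord eqxx dot_base /dradial /radial /GRing.scale/=.
by field; rewrite lt0r_neq0.
Qed.

(** This is the Laplacian of |x|, and the origin of the exponent m = (d - 1) / 2 in the demodulated
    equation. *)
Lemma sum_dradial x : 0 < enorm x ->
  \sum_i dradial i x = (d%:R - 1) / enorm x.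
Proof.
move=> x0; rewrite -mulr_suml; congr (_ / _).
by rewrite sumrB sum_radial_sqr// sumr_const card_ord.
Qed.

End Euclidean.

(** * The equation of the demodulated field and its derivative along rays *)

Section Demodulation.
Context {R : realType} {d : nat} (kappa : R) (O : set 'rV[R]_d).
Implicit Types x v : 'rV[R]_d.
Variables (P Q : 'rV[R]_d -> R) (P1 P2 Q1 Q2 : 'I_d -> 'rV[R]_d -> R).
Hypothesis O_gt0 : forall x, O x -> 0 < enorm x.
Hypothesis dP : forall x i, O x -> is_derive x (base i) P (P1 i x).
Hypothesis dQ : forall x i, O x -> is_derive x (base i) Q (Q1 i x).

(* exp (- i kappa |x|) (P + i Q) = demodRe + i demodIm *)
Definition demodRe x : R := cos (kappa * enorm x) * P x + sin (kappa * enorm x) * Q x.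
Definition demodIm x : R := cos (kappa * enorm x) * Q x - sin (kappa * enorm x) * P x.

(* |x| ^ (- (d - 1) / 2) times the radial derivative of
   |x| ^ ((d - 1) / 2) * demodIm *)
Definition radial_demodIm x : R :=
  cos (kappa * enorm x) * (\sum_i radial i x * Q1 i x - kappa * P x)
  - sin (kappa * enorm x) * (\sum_i radial i x * P1 i x + kappa * Q x)
  + @decay R d / enorm x * demodIm x.

Lemma is_derive_cos_enorm x v : 0 < enorm x ->
  is_derive x v (fun x => cos (kappa * enorm x))
    (- kappa * sin (kappa * enorm x) * (dot x v / enorm x)).
Proof.
move=> x0; have := is_derive_compR (f := kappa \*: (enorm : 'rV[R]_d -> R))
  (is_derive_cos _) (is_deriveZ kappa (is_derive_enorm v x0)).
by congr is_derive; rewrite /GRing.scale/=; ring.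
Qed.

Lemma is_derive_sin_enorm x v : 0 < enorm x ->
  is_derive x v (fun x => sin (kappa * enorm x))
    (kappa * cos (kappa * enorm x) * (dot x v / enorm x)).
Proof.
move=> x0; have := is_derive_compR (f := kappa \*: (enorm : 'rV[R]_d -> R))
  (is_derive_sin _) (is_deriveZ kappa (is_derive_enorm v x0)).
by congr is_derive; rewrite /GRing.scale/=; ring.
Qed.

(** The Helmholtz equation and the squared gradient of the phase each contribute - kappa^2 g; both
    cancel when d_r psi is expressed by d_r g. Only - 2 i kappa (d_r g + (m / |x|) g) is left, and
    its factor i puts the imaginary part of g into the Laplacian of the real part. *)
Lemma has_laplacian_demodRe :
  (forall x i, O x -> is_derive x (base i) (P1 i) (P2 i x)) ->
  (forall x i, O x -> is_derive x (base i) (Q1 i) (Q2 i x)) ->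
  (forall x, O x -> \sum_i P2 i x = - kappa ^+ 2 * P x) ->
  (forall x, O x -> \sum_i Q2 i x = - kappa ^+ 2 * Q x) ->
  has_laplacian O demodRe (fun x => 2 * kappa * radial_demodIm x).
Proof.
move=> dP1 dQ1 HP HQ.
pose c x : R := cos (kappa * enorm x); pose s x : R := sin (kappa * enorm x).
pose n := @radial R d.
have nE i x : dot x (base i) / enorm x = n i x by rewrite dot_base.
(* A + i B is (d_i - i kappa n_i)(P + i Q), so that [c A + s B] is the [i]-th derivative of
   [demodRe]. *)
pose A i x := P1 i x + kappa * (n i x * Q x).
pose B i x := Q1 i x - kappa * (n i x * P x).
exists (fun i x => c x * A i x + s x * B i x).
exists (fun i x => c x * P2 i x + s x * Q2 i x
  + 2 * kappa * c x * (n i x * Q1 i x) - 2 * kappa * s x * (n i x * P1 i x)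
  + kappa * (c x * Q x - s x * P x) * dradial i x
  - kappa ^+ 2 * (c x * P x + s x * Q x) * n i x ^+ 2).
move=> x Ox; have x0 := O_gt0 Ox.
have dc i := is_derive_cos_enorm (base i) x0.
have ds i := is_derive_sin_enorm (base i) x0.
have dn i := is_derive_radial i x0.
split.
- move=> i; have := is_deriveD (is_deriveM (dc i) (dP i Ox))
    (is_deriveM (ds i) (dQ i Ox)).
  congr is_derive; rewrite nE /A /B /c /s /GRing.scale/=; ring.
- move=> i.
  have dA := is_deriveD (dP1 x i Ox)
    (is_deriveZ kappa (is_deriveM (dn i) (dQ i Ox))).
  have dB := is_deriveB (dQ1 x i Ox)
    (is_deriveZ kappa (is_deriveM (dn i) (dP i Ox))).
  have := is_deriveD (is_deriveM (dc i) dA) (is_deriveM (ds i) dB).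
  congr is_derive; rewrite nE /n /c /s /GRing.scale/=.
  have -> : (P1 i + kappa \*: (radial i * Q)) x =
    P1 i x + kappa * (radial i x * Q x) by [].
  have -> : (Q1 i - kappa \*: (radial i * P)) x =
    Q1 i x - kappa * (radial i x * P x) by [].
  ring.
- rewrite !(big_split, sumrN)/= -!mulr_sumr HP// HQ// sum_radial_sqr//.
  rewrite sum_dradial// /radial_demodIm /demodIm /decay -/(c x) -/(s x) -/n.
  by field; rewrite lt0r_neq0.
Qed.

Hypothesis openO : open O.
Hypothesis cP1 : forall x i, O x -> {for x, continuous (P1 i)}.
Hypothesis cQ1 : forall x i, O x -> {for x, continuous (Q1 i)}.

(** The same [radial_demodIm] appears here and in the Laplacian of [demodRe]: a Laplacian in x
    becomes a derivative in the dilation parameter, which can be integrated. *)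
Lemma is_derive_demodIm_ray x (l : R) : 0 < l -> O (l *: x) ->
  is_derive l (1 : R)
    (fun t => enorm (t *: x) `^ @decay R d * demodIm (t *: x))
    (enorm (l *: x) `^ @decay R d * enorm x * radial_demodIm (l *: x)).
Proof.
move=> l0 Oz; set z := l *: x in Oz *.
have z0 := O_gt0 Oz; have nz0 := lt0r_neq0 z0.
have zz : dot z z / enorm z = enorm z.
  by rewrite -sqr_enorm expr2 mulfK.
have zO : nbhs z O by exact: open_nbhs_nbhs.
have dPz : is_derive z z P (\sum_i z 0 i * P1 i z).
  exact: (is_derive_C1 z zO (fun i y Oy => dP i Oy) (fun=> cP1 Oz)).
have dQz : is_derive z z Q (\sum_i z 0 i * Q1 i z).
  exact: (is_derive_C1 z zO (fun i y Oy => dQ i Oy) (fun=> cQ1 Oz)).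
have dc := is_derive_cos_enorm z z0.
have ds := is_derive_sin_enorm z z0.
have dpow := is_derive_compR (is_derive1_powR (@decay R d) z0) (is_derive_enorm z z0).
have dF := is_deriveM dpow (is_deriveB (is_deriveM dc dQz) (is_deriveM ds dPz)).
(* The derivative was taken at [z] in the direction [z] itself, where it is purely radial; division
   by [l] gives the direction [x]. *)
have {}dF := is_derive_scaledir l^-1 dF.
have lz : l^-1 *: z = x by rewrite scalerA mulVf ?scale1r// lt0r_neq0.
have pow : enorm z `^ (@decay R d - 1) * enorm z = enorm z `^ @decay R d.
  by rewrite -{2}[enorm z]powRr1 ?ltW// -powRD ?subrK// nz0 implybT.
have Nx : enorm x = l^-1 * enorm z.
  by rewrite -{1}lz enormZ gtr0_norm// invr_gt0.
have rad (F : 'I_d -> 'rV[R]_d -> R) :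
    \sum_i z 0 i * F i z = enorm z * \sum_i radial i z * F i z.
  rewrite mulr_sumr; apply: eq_bigr => i _; rewrite /radial.
  by field.
rewrite lz in dF.
have ray (h : R) : (h *: (1 : R) + l) *: x = h *: x + l *: x.
  by rewrite scalerDl [h *: _]mulr1.
have := is_derive_affine (s := fun t : R => t *: x) ray dF.
congr is_derive; rewrite !fctE zz Nx !rad /radial_demodIm /demodIm /GRing.scale/= -pow.
by field; rewrite nz0 lt0r_neq0.
Qed.

End Demodulation.

(** * Riemann sums and the Laplacian of finite sums and dilations *)

Section RiemannSums.
Context {R : realType} {d : nat}.
Implicit Types (x z : 'rV[R]_d) (K O B : set 'rV[R]_d) (u L f : 'rV[R]_d -> R).

(** Uniform continuity with only the first point confined to [K]: [f] is continuous at the points of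
    [K] as a function on the whole space. *)
Lemma compact_uniform_near K f (e : R) : compact K -> 0 < e ->
  (forall z, K z -> {for z, continuous f}) ->
  exists2 r : R, 0 < r & forall z z', K z -> box z r z' -> `|f z - f z'| <= e.
Proof.
move=> /compact_near_coveringP cK e0 cf.
pose P (r : R) z := forall z', box z r z' -> `|f z - f z'| <= e.
have H : \forall r \near (0 : R)^'+, K `<=` P r.
  apply: cK => z Kz; have /cvgrPdist_le/(_ (e / 2)) := cf z Kz.
  rewrite divr_gt0// => /(_ isT) /nbhs_box[r r0 br].
  have r20 : 0 < r / 2 by rewrite divr_gt0.
  exists (box z (r / 2), [set s : R | s <= r / 2]) => /=.
    split; last exact: nbhs_right_le.
    apply/nbhs_ballP; exists (r / 2) => //= y; rewrite mx_norm_ball /ball_/=.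
    rewrite /Num.norm/= mx_normrE => /ltW zy i; rewrite distrC.
    apply: le_trans zy; have := @le_bigmax _ _ _ 0 (fun i : 'I_1 * 'I_d => `|(z - y) i.1 i.2|) (0, i).
    by rewrite !mxE.
  move=> [y s] [/= by_ sr] z' bz'.
  have -> : f y - f z' = (f z - f z') - (f z - f y) by ring.
  rewrite (le_trans (ler_normB _ _))// (splitr e) lerD//; apply: br => // i.
    have -> : z' 0 i - z 0 i = (z' 0 i - y 0 i) + (y 0 i - z 0 i) by ring.
    by rewrite (le_trans (ler_normD _ _))// (splitr r) lerD// (le_trans (bz' i)).
  by rewrite (le_trans (by_ i))// ler_piMr ?ltW// invf_lt1// ltr1n.
have : \forall r \near (0 : R)^'+, 0 < r /\ K `<=` P r.
  near=> r; split; near: r; [exact: nbhs_right_gt|exact: H].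
move=> /filter_ex[r [r0 KP]]; exists r => // z z' /KP; exact.
Unshelve. all: by end_near. Qed.

(** The mean value theorem on each cell takes the place of an integral; [e] is the oscillation of
    [H'] from the left end of a cell. *)
Lemma riemann_sum_error (H H' : R -> R) (a h e : R) (n : nat) : 0 <= h ->
  (forall t, a <= t <= a + n%:R * h -> is_derive t (1 : R) H (H' t)) ->
  (forall (j : nat) t, (j < n)%N -> a + j%:R * h <= t <= a + j.+1%:R * h ->
    `|H' t - H' (a + j%:R * h)| <= e) ->
  `|h * (\sum_(j < n) H' (a + j%:R * h)) - (H (a + n%:R * h) - H a)|
    <= n%:R * h * e.
Proof.
move=> h0 dH He.
have <- : \sum_(0 <= j < n) (H (a + j.+1%:R * h) - H (a + j%:R * h)) =
    H (a + n%:R * h) - H a.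
  by rewrite (telescope_sumr (fun j : nat => H (a + j%:R * h)))// mul0r addr0.
rewrite big_mkord mulr_sumr -sumrB (le_trans (ler_norm_sum _ _ _))//.
have -> : n%:R * h * e = \sum_(j < n) h * e.
  by rewrite sumr_const card_ord -[RHS]mulr_natl mulrA.
apply: ler_sum => j _.
have jj : a + j%:R * h <= a + j.+1%:R * h.
  by rewrite lerD2l ler_wpM2r// ler_nat.
have sub t : a + j%:R * h <= t <= a + j.+1%:R * h -> a <= t <= a + n%:R * h.
  move=> /andP[t1 t2]; apply/andP; split.
    by apply: le_trans t1; rewrite lerDl mulr_ge0.
  by apply: (le_trans t2); rewrite lerD2l ler_wpM2r// ler_nat.
have [|t tI ->] := @MVT_sym _ H H' (a + j%:R * h) (a + j.+1%:R * h).
  by rewrite min_l// max_r// => t /sub/dH.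
have -> : a + j.+1%:R * h - (a + j%:R * h) = h by rewrite -natr1; ring.
rewrite mulrC -mulrBl normrM (ger0_norm h0) mulrC ler_wpM2l// distrC.
by apply: He => //; move: tI; rewrite min_l// max_r.
Qed.

Lemma has_laplacianD O u1 u2 L1 L2 :
  has_laplacian O u1 L1 -> has_laplacian O u2 L2 ->
  has_laplacian O (fun x => u1 x + u2 x) (fun x => L1 x + L2 x).
Proof.
move=> [D1 [D2 H]] [E1 [E2 G]].
exists (fun i x => D1 i x + E1 i x), (fun i x => D2 i x + E2 i x) => x Ox.
have [H1 H2 ->] := H x Ox; have [G1 G2 ->] := G x Ox.
by split=> [i|i|]; [exact: is_deriveD|exact: is_deriveD|rewrite big_split].
Qed.

Lemma has_laplacianZ O u L (a : R) : has_laplacian O u L ->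
  has_laplacian O (fun x => a * u x) (fun x => a * L x).
Proof.
move=> [D1 [D2 H]].
exists (fun i x => a * D1 i x), (fun i x => a * D2 i x) => x /H[H1 H2 ->].
by split=> [i|i|]; [exact: is_deriveZ|exact: is_deriveZ|rewrite mulr_sumr].
Qed.

Lemma has_laplacian_sum O n (u L : nat -> 'rV[R]_d -> R) :
  (forall j, (j < n)%N -> has_laplacian O (u j) (L j)) ->
  has_laplacian O (fun x => \sum_(j < n) u j x) (fun x => \sum_(j < n) L j x).
Proof.
elim: n => [_|n IH H].
  under eq_fun do rewrite big_ord0; under [L in has_laplacian _ _ L]eq_fun do rewrite big_ord0.
  exists (fun _ _ => 0), (fun _ _ => 0) => x _.
  by split=> [i|i|]; [exact: is_derive_cst|exact: is_derive_cst|rewrite big1].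
under eq_fun do rewrite big_ord_recr/=.
under [L in has_laplacian _ _ L]eq_fun do rewrite big_ord_recr/=.
apply: has_laplacianD; last exact: H.
by apply: IH => j jn; apply: H; rewrite ltnW.
Qed.

Lemma has_laplacian_scale O u L (l : R) : has_laplacian O u L ->
  has_laplacian [set x | O (l *: x)]
    (fun x => u (l *: x)) (fun x => l ^+ 2 * L (l *: x)).
Proof.
move=> [D1 [D2 H]].
exists (fun i x => l * D1 i (l *: x)), (fun i x => l ^+ 2 * D2 i (l *: x)).
move=> x /= /H[H1 H2 ->]; rewrite mulr_sumr.
have sE i (h : R) : l *: (h *: (base i : 'rV[R]_d) + x) = h *: (l *: base i) + l *: x.
  by rewrite scalerDr !scalerA mulrC.
split=> // i.
  exact: (is_derive_affine (s := fun x => l *: x) (sE i) (is_derive_scaledir l (H1 i))).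
have := is_deriveZ l (is_derive_affine (s := fun x => l *: x) (sE i)
  (is_derive_scaledir l (H2 i))).
by congr is_derive; rewrite /GRing.scale/=; ring.
Qed.

Lemma compact_shell (a b : R) :
  compact [set z : 'rV[R]_d | a <= enorm z <= b].
Proof.
apply: (@subclosed_compact _ _ [set z : 'rV[R]_d | forall i, - b <= z 0 i <= b]).
- have -> : [set z : 'rV[R]_d | a <= enorm z <= b] =
      (enorm : 'rV[R]_d -> R) @^-1` `[a, b]%classic.
    by apply/seteqP; split => z /=; rewrite in_itv.
  apply: preimage_closed; last exact: itv_closed.
  by move=> z _; exact: enorm_continuous.
- exact: compact_box.
- move=> z /= /andP[_ zb] i; rewrite -ler_norml.
  exact: le_trans (coord_le_enorm z i) zb.
Qed.

End RiemannSums.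

(** * Averages along rays and the Lipschitz bound for the far-field pattern *)

Section FarFieldLipschitz.
Context {R : realType} {d : nat}.
Variables (kappa R0 : R) (P Q : 'rV[R]_d -> R).
Variables (P1 P2 Q1 Q2 : 'I_d -> 'rV[R]_d -> R).
Implicit Types x z : 'rV[R]_d.
Hypothesis kappa_gt0 : 0 < kappa.
Hypothesis R0_gt0 : 0 < R0.
Hypothesis dP : forall x i, R0 < enorm x -> is_derive x (base i) P (P1 i x).
Hypothesis dQ : forall x i, R0 < enorm x -> is_derive x (base i) Q (Q1 i x).
Hypothesis dP1 : forall x i, R0 < enorm x -> is_derive x (base i) (P1 i) (P2 i x).
Hypothesis dQ1 : forall x i, R0 < enorm x -> is_derive x (base i) (Q1 i) (Q2 i x).
Hypothesis lapP : forall x, R0 < enorm x -> \sum_i P2 i x = - kappa ^+ 2 * P x.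
Hypothesis lapQ : forall x, R0 < enorm x -> \sum_i Q2 i x = - kappa ^+ 2 * Q x.
Hypothesis cP : forall x, R0 < enorm x -> {for x, continuous P}.
Hypothesis cQ : forall x, R0 < enorm x -> {for x, continuous Q}.
Hypothesis cP1 : forall x i, R0 < enorm x -> {for x, continuous (P1 i)}.
Hypothesis cQ1 : forall x i, R0 < enorm x -> {for x, continuous (Q1 i)}.
Variables (F G : 'rV[R]_d -> R) (C : R).
Hypothesis d_gt0 : (0 < d)%N.
Hypothesis C_ge0 : 0 <= C.
Hypothesis farF : forall x, R0 < enorm x ->
  `|enorm x `^ @decay R d * demodRe kappa P Q x - F ((enorm x)^-1 *: x)|
    <= C / enorm x.
Hypothesis farG : forall x, R0 < enorm x ->
  `|enorm x `^ @decay R d * demodIm kappa P Q x - G ((enorm x)^-1 *: x)|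
    <= C / enorm x.

Let m := @decay R d.
Let O := [set x : 'rV[R]_d | R0 < enorm x].
Let re := demodRe kappa P Q.
Let im := demodIm kappa P Q.
Let dim := radial_demodIm kappa P Q P1 Q1.

Let O_gt0 x : O x -> 0 < enorm x.
Proof. exact: lt_trans. Qed.

Let open_O : open O.
Proof.
have -> : O = (enorm : 'rV[R]_d -> R) @^-1` [set t | R0 < t] by [].
by apply: open_comp; [move=> z _; exact: enorm_continuous|exact: open_gt].
Qed.

Lemma continuous_comp_enorm (phi : R -> R) x (a : R) :
  is_derive (enorm x) (1 : R) phi a -> {for x, continuous (fun x => phi (enorm x))}.
Proof.
move=> dphi; apply: (@continuous_comp _ _ _ (enorm : 'rV[R]_d -> R) phi).
  exact: enorm_continuous.
exact: is_derive_continuous dphi.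
Qed.

Lemma continuous_cos_enorm x : {for x, continuous (fun x => cos (kappa * enorm x))}.
Proof.
exact: (@continuous_comp_enorm (cos \o ( *%R kappa)) x).
Qed.

Lemma continuous_sin_enorm x : {for x, continuous (fun x => sin (kappa * enorm x))}.
Proof.
exact: (@continuous_comp_enorm (sin \o ( *%R kappa)) x).
Qed.

Lemma continuous_powR_enorm (a : R) x : 0 < enorm x ->
  {for x, continuous (fun x => enorm x `^ a)}.
Proof.
by move=> x0; apply: (@continuous_comp_enorm (@powR R ^~ a) x);
  exact: is_derive1_powR.
Qed.

Lemma continuous_demodRe x : R0 < enorm x -> {for x, continuous re}.
Proof.
move=> x0; apply: continuousD; apply: continuousM.
- exact: continuous_cos_enorm.
- exact: cP.
- exact: continuous_sin_enorm.
- exact: cQ.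
Qed.

Lemma continuous_demodIm x : R0 < enorm x -> {for x, continuous im}.
Proof.
move=> x0; apply: continuousB; apply: continuousM.
- exact: continuous_cos_enorm.
- exact: cQ.
- exact: continuous_sin_enorm.
- exact: cP.
Qed.

Lemma continuous_radial_demodIm x : R0 < enorm x -> {for x, continuous dim}.
Proof.
move=> x0; have x_gt0 := O_gt0 x0.
have cV : {for x, continuous (fun x => (enorm x)^-1)}.
  apply: (@continuousV _ _ (enorm : 'rV[R]_d -> R)); first exact: lt0r_neq0.
  exact: enorm_continuous.
have crad (D : 'I_d -> 'rV[R]_d -> R) : (forall i, {for x, continuous (D i)}) ->
    {for x, continuous (fun x => \sum_i radial i x * D i x)}.
  move=> cD; apply: continuous_sum => i.
  apply: (@continuousM _ _ (@radial R d i) (D i)) => //.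
  apply: (@continuousM _ _ (fun x : 'rV[R]_d => x 0 i) (fun x => (enorm x)^-1)) => //.
  exact: coord_continuous.
have ck (f : 'rV[R]_d -> R) : {for x, continuous f} ->
    {for x, continuous (fun x => kappa * f x)}.
  by move=> cf; apply: (@continuousM _ _ (fun=> kappa) f) => //; exact: cst_continuous.
apply: continuousD.
  apply: continuousB; apply: continuousM.
  - exact: continuous_cos_enorm.
  - by apply: continuousB; [apply: crad => i; exact: cQ1|exact/ck/cP].
  - exact: continuous_sin_enorm.
  - by apply: continuousD; [apply: crad => i; exact: cP1|exact/ck/cQ].
apply: continuousM; last exact: continuous_demodIm.
by apply: (@continuousM _ _ (fun=> m) (fun x => (enorm x)^-1)) => //; exact: cst_continuous.
Qed.

Let H x (t : R) := enorm (t *: x) `^ m * im (t *: x).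
Let H' x (t : R) := enorm (t *: x) `^ m * enorm x * dim (t *: x).

(** One [n] serves all [x], since every point met lies in the compact shell rho / 2 <= |z| <= 4 rho.
    The tolerance 1 / rho has the order of [H x (rho + rho) - H x rho] itself. *)
Lemma ray_riemann_sum (rho : R) : 2 * R0 < rho -> exists2 n : nat, (0 < n)%N &
  forall x, 2^-1 <= enorm x <= 2 ->
  `|rho / n%:R * (\sum_(j < n) H' x (rho + j%:R * (rho / n%:R)))
    - (H x (rho + rho) - H x rho)| <= rho^-1.
Proof.
move=> hrho; have rho0 : 0 < rho by rewrite (lt_trans _ hrho)// mulr_gt0.
pose T z := enorm z `^ m * dim z.
pose K := [set z : 'rV[R]_d | rho / 2 <= enorm z <= 4 * rho].
have KO z : K z -> O z.
  by move=> /andP[+ _]; apply: lt_le_trans; rewrite ltr_pdivlMr// mulrC.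
have cT z : K z -> {for z, continuous T}.
  move=> /KO Oz; apply: continuousM; last exact: continuous_radial_demodIm.
  exact/continuous_powR_enorm/O_gt0.
(* The interval has length rho and [H'] carries a factor |x| <= 2, so the total error is rho * 2 e =
   1 / rho. *)
pose e := (2 * rho ^+ 2)^-1.
have e0 : 0 < e by rewrite invr_gt0 mulr_gt0// exprn_gt0.
have [r r0 Tr] := compact_uniform_near (@compact_shell R d _ _) e0 cT.
(* Within a cell the coordinates of [t *: x] move by at most 2 h; this [n] gives 2 h <= r, and the
   successor keeps it positive. *)
pose n := (Num.Def.archi_bound (2 * rho / r)).+1.
exists n => // x /andP[x1 x2].
have n0 : 0 < n%:R :> R by rewrite ltr0n.
have x0 : 0 < enorm x by rewrite (lt_le_trans _ x1)// invr_gt0.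
pose h := rho / n%:R; rewrite -/h.
have h0 : 0 < h by rewrite divr_gt0.
have nh : n%:R * h = rho by rewrite mulrC divfK// lt0r_neq0.
have hr : 2 * h <= r.
  rewrite /h mulrA ler_pdivrMr// [r * _]mulrC -ler_pdivrMr//.
  apply: (@le_trans _ _ (Num.Def.archi_bound (2 * rho / r))%:R).
    by apply/ltW/archi_boundP; rewrite divr_ge0 ?mulr_ge0 ?ltW.
  by rewrite ler_nat.
have inK t : rho <= t <= rho + rho -> K (t *: x).
  move=> /andP[t1 t2]; have t0 := lt_le_trans rho0 t1.
  rewrite /K/= enormZ gtr0_norm//; apply/andP; split.
    by apply: ler_pM => //; rewrite ?invr_ge0// ltW.
  apply: (@le_trans _ _ ((rho + rho) * 2)); last by lra.
  by apply: ler_pM => //; rewrite ltW.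
have -> : rho^-1 = n%:R * h * (2 * e).
  by rewrite nh /e; field; rewrite lt0r_neq0.
rewrite [in H x _](_ : rho + rho = rho + n%:R * h); last by rewrite nh.
apply: (@riemann_sum_error R (H x) (H' x)); first exact: ltW.
  move=> t; rewrite nh => tI; have t0 : 0 < t.
    by rewrite (lt_le_trans rho0)//; case/andP: tI.
  exact: (is_derive_demodIm_ray kappa O_gt0 dP dQ open_O cP1 cQ1 t0 (KO _ (inK _ tI))).
move=> j t jn /andP[t1 t2].
have jh0 : 0 <= j%:R * h by rewrite mulr_ge0// ltW.
have jh : j.+1%:R * h <= rho by rewrite -[leRHS]nh ler_wpM2r ?ler_nat// ltW.
have jS : j.+1%:R * h = j%:R * h + h by rewrite -natr1; ring.
set s := rho + j%:R * h in t1 t2 *.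
have -> : H' x t - H' x s = enorm x * (T (t *: x) - T (s *: x)).
  by rewrite /H' /T; ring.
rewrite normrM (gtr0_norm x0); apply: ler_pM => //; first exact: ltW.
rewrite distrC; apply: Tr; first by apply: inK; rewrite /s; lra.
move=> i; rewrite !mxE -mulrBl normrM.
apply: le_trans hr; rewrite mulrC; apply: ler_pM => //.
  exact: le_trans (coord_le_enorm x i) x2.
rewrite ger0_norm; last by rewrite subr_ge0.
by rewrite /s in t1 t2 *; lra.
Qed.

(* A Riemann sum over t in [rho, 2 rho] of
   rho t^(m - 2) Re (exp (- i kappa |t x|) psi (t x)); with this weight the
   Laplacian in x of the integrand is a multiple of the t-derivative H' x t. *)
Let average (rho : R) (n : nat) x : R :=
  \sum_(j < n) rho * (rho / n%:R) *
    (rho + j%:R * (rho / n%:R)) `^ m / (rho + j%:R * (rho / n%:R)) ^+ 2 *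
    re ((rho + j%:R * (rho / n%:R)) *: x).

(** The factor l_j^2 of the dilation cancels the l_j^-2 of the weight, and l_j^m = |l_j x|^m / |x|^m
    restores the terms of [H']. *)
Lemma average_laplacian (rho : R) n : 2 * R0 < rho -> (0 < n)%N ->
  has_laplacian [set x | 2^-1 <= enorm x <= 2] (average rho n)
    (fun x => 2 * kappa * rho * (enorm x `^ m * enorm x)^-1 *
      (rho / n%:R * (\sum_(j < n) H' x (rho + j%:R * (rho / n%:R))))).
Proof.
move=> hrho n0; have rho0 : 0 < rho by rewrite (lt_trans _ hrho)// mulr_gt0.
pose l j : R := rho + j%:R * (rho / n%:R).
have rl j : rho <= l j by rewrite lerDl mulr_ge0// divr_ge0// ltW.
have l0 j : 0 < l j by rewrite (lt_le_trans rho0).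
have hl := @has_laplacian_demodRe _ _ kappa O _ _ _ _ _ _ O_gt0 dP dQ dP1 dQ1 lapP lapQ.
pose w j := rho * (rho / n%:R) * l j `^ m / l j ^+ 2.
have hj j : has_laplacian [set x | 2^-1 <= enorm x <= 2]
    (fun x => w j * re (l j *: x))
    (fun x => w j * (l j ^+ 2 * (2 * kappa * dim (l j *: x)))).
  apply: has_laplacianZ; apply: has_laplacianW (has_laplacian_scale (l j) hl).
  move=> x /andP[x1 _]; rewrite /O/= enormZ gtr0_norm//.
  apply: (@lt_le_trans _ _ (rho * 2^-1)); first by rewrite ltr_pdivlMr// mulrC.
  by apply: ler_pM => //; rewrite ?invr_ge0// ltW.
have [D1 [D2 HD]] := @has_laplacian_sum R d _ n _ _ (fun j _ => hj j).
exists D1, D2 => x Bx; have [H1 H2 E] := HD x Bx; split=> //.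
rewrite -E !mulr_sumr; apply: eq_bigr => j _; rewrite /H' -/(l j) /w.
have x0 : 0 < enorm x by case/andP: Bx => x1 _; rewrite (lt_le_trans _ x1)// invr_gt0.
rewrite enormZ gtr0_norm// powRM ?ltW//.
have xm : 0 < enorm x `^ m by rewrite powR_gt0.
by field; rewrite !lt0r_neq0 ?ltr0n.
Qed.

Let scale_gt x (t : R) : 0 < t -> 2^-1 <= enorm x ->
  t / 2 <= enorm (t *: x).
Proof. by move=> t0 x1; rewrite enormZ gtr0_norm// ler_pM2l. Qed.

Let scaleO x (t : R) : 2 * R0 < t -> 2^-1 <= enorm x -> O (t *: x).
Proof.
move=> ht x1; have t0 : 0 < t by rewrite (lt_trans _ ht)// mulr_gt0.
by apply: lt_le_trans (scale_gt t0 x1); rewrite ltr_pdivlMr// mulrC.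
Qed.

(** All points of a ray share one direction, so the limit does not depend on t. The factor 2 comes
    from |t x| >= rho / 2. *)
Let far_along (phi psi : 'rV[R]_d -> R) :
  (forall x, R0 < enorm x ->
    `|enorm x `^ m * phi x - psi ((enorm x)^-1 *: x)| <= C / enorm x) ->
  forall x (t rho : R), 2 * R0 < rho -> rho <= t -> 2^-1 <= enorm x ->
  `|enorm (t *: x) `^ m * phi (t *: x) - psi ((enorm x)^-1 *: x)| <= 2 * C / rho.
Proof.
move=> far x t rho hrho rt x1.
have rho0 : 0 < rho by rewrite (lt_trans _ hrho)// mulr_gt0.
have t0 := lt_le_trans rho0 rt; have x0 : 0 < enorm x.
  by rewrite (lt_le_trans _ x1)// invr_gt0.
have -> : (enorm x)^-1 *: x = (enorm (t *: x))^-1 *: (t *: x).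
  rewrite enormZ gtr0_norm// scalerA; congr (_ *: _).
  by field; rewrite !lt0r_neq0.
apply: (le_trans (far _ (scaleO (lt_le_trans hrho rt) x1))).
have -> : 2 * C / rho = C / (rho / 2) by field; rewrite lt0r_neq0.
rewrite ler_wpM2l// lef_pV2 ?posrE ?divr_gt0//; last first.
  by rewrite enormZ gtr0_norm// mulr_gt0.
by apply: le_trans (scale_gt t0 x1); rewrite ler_wpM2r// invr_ge0.
Qed.

(** The total mass of the average, a Riemann sum of rho t^-2 over [rho, 2 rho], whose integral is 1
    / 2. Bounds independent of rho suffice, and they follow from rho <= t <= 2 rho. *)
Let weight (rho : R) (n : nat) : R :=
  \sum_(j < n) rho * (rho / n%:R) / (rho + j%:R * (rho / n%:R)) ^+ 2.

Lemma weight_bounds (rho : R) n : 0 < rho -> (0 < n)%N ->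
  4^-1 <= weight rho n <= 1.
Proof.
move=> rho0 n0; have n0' : 0 < n%:R :> R by rewrite ltr0n.
pose h := rho / n%:R; have h0 : 0 < h by rewrite divr_gt0.
have sumc (c : R) : n%:R * c = \sum_(j < n) c.
  by rewrite sumr_const card_ord -[RHS]mulr_natl.
have nh : n%:R * h = rho by rewrite mulrC divfK// lt0r_neq0.
have lj0 (j : nat) : 0 < rho + j%:R * h by rewrite ltr_wpDr// mulr_ge0// ltW.
rewrite /weight; apply/andP; split.
  have -> : 4^-1 = n%:R * (rho * h / (rho + rho) ^+ 2) :> R.
    rewrite -[in LHS](mulr1 4^-1) /h.
    by field; rewrite -mulr2n mulrn_eq0/= !lt0r_neq0.
  rewrite sumc; apply: ler_sum => j _; rewrite -/h.
  apply: ler_wpM2l; first by rewrite mulr_ge0 ?ltW.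
  rewrite lef_pV2 ?posrE ?exprn_gt0 ?lj0 ?addr_gt0//.
  rewrite ler_pXn2r ?nnegrE ?(ltW (lj0 _)) ?addr_ge0 ?(ltW rho0)//.
  by rewrite lerD2l -[leRHS]nh ler_pM2r// ler_nat ltnW.
have E1 : 1 = n%:R * (rho * h / rho ^+ 2).
  by rewrite /h; field; rewrite !lt0r_neq0.
rewrite [X in _ <= X]E1 sumc; apply: ler_sum => j _; rewrite -/h.
apply: ler_wpM2l; first by rewrite mulr_ge0 ?ltW.
rewrite lef_pV2 ?posrE ?exprn_gt0 ?lj0//.
rewrite ler_pXn2r ?nnegrE ?(ltW (lj0 _)) ?(ltW rho0)//.
by rewrite lerDl mulr_ge0// ltW.
Qed.

Lemma average_far (rho : R) n x : 2 * R0 < rho -> (0 < n)%N ->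
  2^-1 <= enorm x <= 2 ->
  `|average rho n x - (enorm x `^ m)^-1 * (weight rho n * F ((enorm x)^-1 *: x))|
    <= (enorm x `^ m)^-1 * (2 * C / rho).
Proof.
move=> hrho n0 /andP[x1 x2].
have rho0 : 0 < rho by rewrite (lt_trans _ hrho)// mulr_gt0.
have x0 : 0 < enorm x by rewrite (lt_le_trans _ x1)// invr_gt0.
have xm : 0 < enorm x `^ m by rewrite powR_gt0.
have /andP[_ W1] := weight_bounds rho0 n0.
pose l j : R := rho + j%:R * (rho / n%:R).
have rl j : rho <= l j by rewrite lerDl mulr_ge0// divr_ge0// ltW.
have l0 j : 0 < l j by rewrite (lt_le_trans rho0).
pose w j := rho * (rho / n%:R) / l j ^+ 2.
have w0 j : 0 <= w j by rewrite !(mulr_ge0, invr_ge0, exprn_ge0) ?ltW ?ltr0n.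
have -> : average rho n x = (enorm x `^ m)^-1 *
    \sum_(j < n) w j * (enorm (l j *: x) `^ m * re (l j *: x)).
  rewrite mulr_sumr; apply: eq_bigr => j _; rewrite -/(l j) /w.
  rewrite enormZ gtr0_norm// powRM ?ltW//.
  by field; rewrite !lt0r_neq0 ?ltr0n.
rewrite -mulrBr normrM gtr0_norm ?invr_gt0//.
apply: ler_wpM2l; first by rewrite invr_ge0 ltW.
rewrite /weight -/l mulr_suml -sumrB.
apply: (@le_trans _ _ (\sum_(j < n) w j * (2 * C / rho))); last first.
  by rewrite -mulr_suml; apply: ler_piMl => //; rewrite divr_ge0 ?mulr_ge0 ?(ltW rho0).
apply: (le_trans (ler_norm_sum _ _ _)); apply: ler_sum => j _.
rewrite -/(l j) -/(w j) -mulrBr normrM ger0_norm// ler_wpM2l//.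
exact: (far_along farF).
Qed.

Lemma continuous_average (rho : R) n x : 2 * R0 < rho -> (0 < n)%N ->
  2^-1 <= enorm x -> {for x, continuous (average rho n)}.
Proof.
move=> hrho n0 x1; have rho0 : 0 < rho by rewrite (lt_trans _ hrho)// mulr_gt0.
apply: continuous_sum => j; pose l := rho + j%:R * (rho / n%:R).
apply: (@continuousM _ _ (fun=> rho * (rho / n%:R) * l `^ m / l ^+ 2)
  (fun x => re (l *: x))).
  exact: cst_continuous.
apply: (@continuous_comp _ _ _ (fun x : 'rV[R]_d => l *: x) re).
  exact: scaler_continuous.
apply: continuous_demodRe; apply: scaleO => //; apply: (lt_le_trans hrho).
by rewrite lerDl mulr_ge0// divr_ge0// ltW.
Qed.

(** On the sphere the average is within 2 C / rho of [weight * F], and its Lipschitz constant [A]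
    does not depend on rho. Dividing by the weight, at least 1 / 4, and letting rho grow gives the
    constant 4 A. *)
Lemma far_field_lipschitz theta : enorm theta = 1 ->
  exists A r : R, [/\ 0 <= A, 0 < r & forall x, enorm x = 1 -> box theta r x ->
    `|F x - F theta| <= A * \sum_i `|x 0 i - theta 0 i|].
Proof.
move=> th1.
have half1 : 2^-1 <= 1 :> R by rewrite invf_le1// ler1n.
(* A bound for [F] near [theta] comes from the field at one fixed radius [R1]: it is continuous,
   hence locally bounded, and differs from [F] by at most C / R0. *)
pose R1 := 2 * R0 + 1; have hR1 : 2 * R0 < R1 by rewrite ltrDl.
have R10 : 0 < R1 by rewrite (lt_trans _ hR1)// mulr_gt0.
pose g x := enorm (R1 *: x) `^ m * re (R1 *: x).
have cg : {for theta, continuous g}.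
  have Oth : O (R1 *: theta) by apply: scaleO; rewrite ?th1.
  apply: (@continuous_comp _ _ _ (fun x : 'rV[R]_d => R1 *: x)
     (fun z => enorm z `^ m * re z)).
    exact: scaler_continuous.
  apply: continuousM; last exact: continuous_demodRe.
  exact/continuous_powR_enorm/O_gt0.
have cN : {for theta, continuous (enorm : 'rV[R]_d -> R)} by exact: enorm_continuous.
have : \forall x \near theta, 2^-1 <= enorm x <= 2 /\ `|g theta - g x| <= 1.
  near=> x; split; last by near: x; move/cvgrPdist_le : cg; apply.
  apply/andP; split; near: x.
    by apply: (cvgr_ge _ cN); rewrite th1 invf_lt1// ltr1n.
  by apply: (cvgr_le _ cN); rewrite th1 ltr1n.
move=> /nbhs_box[r r0 rN].
have r20 : 0 < r / 2 by rewrite divr_gt0.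
pose K := ((2^-1 : R) `^ m)^-1.
have m0 : 0 <= m by rewrite divr_ge0// subr_ge0 ler1n.
have K0 : 0 < K by rewrite invr_gt0 powR_gt0// invr_gt0.
have NK x : 2^-1 <= enorm x -> (enorm x `^ m)^-1 <= K.
  move=> x1; have x0 : 0 < enorm x by rewrite (lt_le_trans _ x1)// invr_gt0.
  rewrite lef_pV2 ?posrE ?powR_gt0 ?invr_gt0//.
  by apply: ge0_ler_powR => //; rewrite nnegrE ?invr_ge0 ?(ltW x0).
pose M1 := `|g theta| + 1 + C / R0.
have CR0 : 0 <= C / R0 by rewrite divr_ge0// ltW.
have M10 : 0 <= M1 by rewrite !addr_ge0.
have small rho : 2 * R0 < rho -> 2 * C / rho <= C / R0.
  move=> hrho; have rho0 : 0 < rho by rewrite (lt_trans _ hrho)// mulr_gt0.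
  have -> : 2 * C / rho = C / (rho / 2) by field; rewrite lt0r_neq0.
  rewrite ler_wpM2l// lef_pV2 ?posrE ?divr_gt0//.
  by rewrite ler_pdivlMr// mulrC ltW.
have FM x : box theta r x -> `|F ((enorm x)^-1 *: x)| <= M1.
  move=> /rN[/andP[x1 x2] gx].
  have := le_trans (far_along farF hR1 (lexx R1) x1) (small _ hR1).
  rewrite -/(g x) /M1; move: gx; rewrite !ler_distl.
  have := ler_norm (g theta); have := ler_norm (- g theta); rewrite normrN.
  move=> n1 n2 /andP[a1 a2] /andP[b1 b2].
  by rewrite ler_norml; apply/andP; split; lra.
(* The first summand bounds the average, the second its Laplacian; neither involves rho. *)
pose M := K * (M1 + C / R0) + 4 * kappa * K * (4 * C + 1).
have KM0 : 0 <= K * (M1 + C / R0) by rewrite mulr_ge0 ?addr_ge0 ?(ltW K0).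
have KL0 : 0 <= 4 * kappa * K * (4 * C + 1).
  by rewrite !mulr_ge0 ?addr_ge0 ?mulr_ge0 ?(ltW K0) ?(ltW kappa_gt0).
have M0 : 0 <= M by rewrite addr_ge0.
pose A := @lip_const R d M (r / 2).
have A0 : 0 <= A by exact: lip_const_ge0.
exists (4 * A), (r / 2); split; rewrite ?mulr_ge0//.
move=> x x1 bx; set S := \sum_i _.
have S0 : 0 <= S by rewrite sumr_ge0.
apply/ler_addgt0Pr => e e0.
(* The average misses [weight * F] by 2 C / rho at each of two points, and dividing by the weight
   costs a factor 4: in all 16 C / rho <= e. *)
pose rho := 2 * R0 + 1 + 16 * C / e.
have Ce : 0 <= 16 * C / e by rewrite divr_ge0 ?mulr_ge0// ltW.
have hrho : 2 * R0 < rho by rewrite /rho -addrA ltrDl ltr_pwDl.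
have rho0 : 0 < rho by rewrite (lt_trans _ hrho)// mulr_gt0.
have [n n0 riem] := ray_riemann_sum hrho.
have /andP[W4 W1] := weight_bounds rho0 n0.
have W0 : 0 <= weight rho n by rewrite (le_trans _ W4)// invr_ge0.
have b2 : box theta (r / 2 + r / 2) `<=` [set x | 2^-1 <= enorm x <= 2].
  by rewrite -splitr => z /rN[].
have := @laplacian_lipschitz R d _ _ _ M (r / 2) theta M0 r20
  (has_laplacianW b2 (average_laplacian hrho n0)) _ (fun _ Z => Z) _ _ x bx.
move=> /(_ _ _ _)H0.
have {H0} : `|average rho n x - average rho n theta| <= A * S.
  apply: H0.
  - by move=> z /b2 /andP[z1 _]; exact: continuous_average.
  - move=> z bz; have zB := b2 _ bz; have /andP[z1 z2] := zB.
    have zK := NK _ z1; have z0 : 0 < enorm z by rewrite (lt_le_trans _ z1)// invr_gt0.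
    have zi0 : 0 <= (enorm z `^ m)^-1 by rewrite invr_ge0 powR_ge0.
    have H1 := average_far hrho n0 zB.
    have H2 : `|(enorm z `^ m)^-1 * (weight rho n * F ((enorm z)^-1 *: z))| <= K * M1.
      rewrite normrM ger0_norm//; apply: ler_pM => //.
      rewrite normrM ger0_norm// -[M1]mul1r; apply: ler_pM => //.
      by apply: FM; rewrite [r]splitr.
    have H3 : (enorm z `^ m)^-1 * (2 * C / rho) <= K * (C / R0).
      by apply: ler_pM => //; [rewrite divr_ge0 ?mulr_ge0 ?(ltW rho0)|exact: small].
    rewrite -[average rho n z](subrK ((enorm z `^ m)^-1 * (weight rho n * F ((enorm z)^-1 *: z)))).
    rewrite (le_trans (ler_normD _ _))//.
    apply: (@le_trans _ _ (K * (C / R0) + K * M1)).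
      by rewrite lerD// (le_trans H1).
    by rewrite -mulrDr [C / R0 + _]addrC /M lerDl.
  - move=> z bz; have zB := b2 _ bz; have /andP[z1 z2] := zB.
    have z0 : 0 < enorm z by rewrite (lt_le_trans _ z1)// invr_gt0.
    have zm0 : 0 < enorm z `^ m by rewrite powR_gt0.
    (* Both values approximate [G] at the same direction, so [G] cancels and the rate remains. It
       offsets the factor rho in front of the Laplacian of the average. *)
    have HH : `|H z (rho + rho) - H z rho| <= 4 * C / rho.
      have rr : rho <= rho + rho by rewrite lerDl ltW.
      have h1 := far_along farG hrho rr z1.
      have h2 := far_along farG hrho (lexx rho) z1.
      move: h1 h2; rewrite -/(H z (rho + rho)) -/(H z rho) !ler_distl.
      have -> : 2 * C / rho = 2 * (C / rho) by rewrite mulrA.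
      have -> : 4 * C / rho = 4 * (C / rho) by rewrite mulrA.
      move=> /andP[a1 a2] /andP[c1 c2]; apply/andP; split; lra.
    set X := _ * \sum_(j < n) _.
    have X1 : `|X| <= (4 * C + 1) / rho.
      rewrite -[X](subrK (H z (rho + rho) - H z rho)).
      rewrite (le_trans (ler_normD _ _))// mulrDl mul1r addrC lerD//.
      exact: riem.
    clearbody X.
    rewrite !normrM (gtr0_norm kappa_gt0) (gtr0_norm rho0) (@gtr0_norm _ 2)//.
    rewrite gtr0_norm ?invr_gt0 ?mulr_gt0// invfM.
    have N2 : (enorm z)^-1 <= 2.
      by rewrite -[2]invrK lef_pV2 ?posrE ?invr_gt0.
    apply: (@le_trans _ _ (2 * kappa * rho * (K * 2) * ((4 * C + 1) / rho))).
      apply: ler_pM => //.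
        by rewrite !mulr_ge0 ?invr_ge0 ?ltW.
      apply: ler_wpM2l; [by rewrite !mulr_ge0 ?ltW|apply: ler_pM => //];
        rewrite ?invr_ge0 ?(ltW zm0) ?(ltW z0)//.
      exact: NK.
    have -> : 2 * kappa * rho * (K * 2) * ((4 * C + 1) / rho) =
        4 * kappa * K * (4 * C + 1) by field; rewrite lt0r_neq0.
    by rewrite /M lerDr.
have sphere z : enorm z = 1 -> `|average rho n z - weight rho n * F z| <= 2 * C / rho.
  move=> zN; have := @average_far rho n z hrho n0.
  by rewrite zN powR1 invr1 !mul1r scale1r; apply; rewrite half1 ler1n.
have := sphere _ x1; have := sphere _ th1.
have Crho : 16 * (C / rho) <= e.
  rewrite mulrA ler_pdivrMr// -ler_pdivrMl// mulrC /rho.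
  by rewrite lerDr addr_ge0// mulr_ge0 ?ltW.
have -> : 2 * C / rho = 2 * (C / rho) by rewrite mulrA.
move=> s1 s2 s3.
have : `|weight rho n * (F x - F theta)| <= A * S + 4 * (C / rho).
  have -> : weight rho n * (F x - F theta) =
    (average rho n x - average rho n theta) -
    ((average rho n x - weight rho n * F x) -
     (average rho n theta - weight rho n * F theta)) by ring.
  have := ler_normB (average rho n x - average rho n theta)
    ((average rho n x - weight rho n * F x) -
     (average rho n theta - weight rho n * F theta)).
  have := ler_normB (average rho n x - weight rho n * F x)
     (average rho n theta - weight rho n * F theta).
  lra.
rewrite normrM ger0_norm// => s4.
have : 4^-1 * `|F x - F theta| <= weight rho n * `|F x - F theta|.
  by rewrite ler_wpM2r.
rewrite -mulrA; lra.
Unshelve. all: by end_near. Qed.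

End FarFieldLipschitz.

(** * Expansion of the phaseless data and geometry of the shifted point *)

Section PhaselessAmplitude.
Context {R : realType} {d : nat}.
Implicit Types (x z theta zeta k : 'rV[R]_d) (psi : 'rV[R]_d -> R[i]).

Let RePart psi x : R := complex.Re (psi x).
Let ImPart psi x : R := complex.Im (psi x).

(** |exp(i k z) + psi|^2 - 1 = 2 Re(exp(- i k z) psi) + |psi|^2, where psi = exp(i kappa |z|) |z|^(-
    m) (p + i q). *)
Lemma a_fun_expand psi k kappa z : 0 < enorm z ->
  let p := enorm z `^ @decay R d * demodRe kappa (RePart psi) (ImPart psi) z in
  let q := enorm z `^ @decay R d * demodIm kappa (RePart psi) (ImPart psi) z in
  let A := dot k z - kappa * enorm z in
  a_fun psi k z = 2 * (p * cos A + q * sin A)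
    + (enorm z `^ @decay R d)^-1 * (p ^+ 2 + q ^+ 2).
Proof.
move=> z0 p q A; rewrite /a_fun /psi0 /expi /p /q /A /demodRe /demodIm /RePart /ImPart.
have : 0 < enorm z `^ @decay R d by rewrite powR_gt0.
move: (enorm z `^ _) => N N0; case: (psi z) => P Q /=.
rewrite sqr_sqrtr ?addr_ge0 ?sqr_ge0// cosB sinB.
have := cos2Dsin2 (dot k z); have := cos2Dsin2 (kappa * enorm z).
move: (cos (dot k z)) (sin (dot k z)) => c1 s1.
move: (cos (kappa * enorm z)) (sin (kappa * enorm z)) => c s cs cs1.
have -> : (c1 + P) ^+ 2 + (s1 + Q) ^+ 2 - 1 =
    2 * (c1 * P + s1 * Q) + (P ^+ 2 + Q ^+ 2).
  by rewrite -[X in _ - X = _]cs1; ring.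
transitivity (N * (c ^+ 2 + s ^+ 2) * (2 * (c1 * P + s1 * Q) + (P ^+ 2 + Q ^+ 2))).
  by rewrite cs mulr1.
by field; rewrite lt0r_neq0.
Qed.

(** [sigma] is the minimum of 1 and [decay], so it absorbs both the linear error 1 / r and the
    quadratic term r^(- m). *)
Lemma powR_sigma (r : R) : (2 <= d)%N -> 1 <= r ->
  r^-1 <= r `^ (- sigma R d) /\ (r `^ @decay R d)^-1 <= r `^ (- sigma R d).
Proof.
move=> d2 r1; have r0 : 0 < r by rewrite (lt_le_trans _ r1).
have [s1 sd] : sigma R d <= 1 /\ sigma R d <= @decay R d.
  rewrite /sigma /decay; case: eqP => [->|/eqP dn2].
    have -> : (2%R : nat)%:R = 1 + 1 :> R by [].
    by split; [rewrite invf_le1 ?addr_gt0// lerDl|rewrite addrK mul1r].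
  split=> //; rewrite ler_pdivlMr// mul1r lerBrDr.
  have : (3 <= d)%N by rewrite ltn_neqAle d2 andbT eq_sym; exact: dn2.
  by rewrite natr1 ler_nat.
split; first by rewrite -powR_inv1 ?(ltW r0)// ler_powR// lerN2.
by rewrite -powRN ler_powR// lerN2.
Qed.

(** First the error of the linear term, with the cosine and sine bounded by 1, then the quadratic
    term, where 2^m accounts for |z| >= r / 2. *)
Definition amplitude_error (E F G : R) : R :=
  4 * E + 2 `^ @decay R d * ((`|F| + E) ^+ 2 + (`|G| + E) ^+ 2).

(** Stated in terms of [r] and not of |z|, so that x, with |x| = r, and y, with |y| >= r / 2, get
    the same bound. *)
Lemma a_fun_estimate psi k kappa z (F G E r : R) : (2 <= d)%N ->
  1 <= r -> r / 2 <= enorm z -> 0 <= E ->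
  `|enorm z `^ @decay R d * demodRe kappa (RePart psi) (ImPart psi) z - F| <= E / r ->
  `|enorm z `^ @decay R d * demodIm kappa (RePart psi) (ImPart psi) z - G| <= E / r ->
  `|a_fun psi k z - 2 * (F * cos (dot k z - kappa * enorm z)
                       + G * sin (dot k z - kappa * enorm z))|
  <= amplitude_error E F G * r `^ (- sigma R d).
Proof.
move=> d2 r1 rz E0; have r0 : 0 < r by rewrite (lt_le_trans _ r1).
have z0 : 0 < enorm z by rewrite (lt_le_trans _ rz)// divr_gt0.
rewrite (a_fun_expand psi k kappa z0).
move: (_ * demodRe _ _ _ _) (_ * demodIm _ _ _ _) => p q.
move: (dot k z - _) => A pF qG.
have [rs ms] := powR_sigma d2 r1.
have m0 : 0 <= @decay R d by rewrite divr_ge0// subr_ge0 ler1n (leq_trans _ d2).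
have Nm : (enorm z `^ @decay R d)^-1 <= 2 `^ @decay R d * r `^ (- sigma R d).
  apply: (@le_trans _ _ ((r / 2) `^ @decay R d)^-1).
    rewrite lef_pV2 ?posrE ?powR_gt0 ?divr_gt0//.
    by apply: ge0_ler_powR => //; rewrite nnegrE ?divr_ge0 ?(ltW r0) ?(ltW z0).
  have -> : ((r / 2) `^ @decay R d)^-1 = 2 `^ @decay R d * (r `^ @decay R d)^-1.
    rewrite -{2}[r](divfK (_ : 2 != 0))// [in RHS]powRM ?divr_ge0 ?(ltW r0)//.
    by field; rewrite !lt0r_neq0 ?powR_gt0 ?divr_gt0.
  by rewrite ler_wpM2l// powR_ge0.
have E1 : E / r <= E by rewrite ler_pdivrMr// ler_peMr.
have sqr_le (a b : R) : `|a - b| <= E / r -> a ^+ 2 <= (`|b| + E) ^+ 2.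
  move=> ab; rewrite -[a ^+ 2]real_normK ?num_real// ler_pXn2r ?nnegrE ?addr_ge0//.
  rewrite -[a](subrK b) addrC (le_trans (ler_normD _ _))// lerD2l.
  exact: le_trans E1.
have err : `|2 * ((p - F) * cos A + (q - G) * sin A)| <= 4 * (E / r).
  rewrite normrM (@gtr0_norm _ 2)//.
  have -> : 4 * (E / r) = 2 * (E / r * 1 + E / r * 1) by ring.
  rewrite ler_pM2l// (le_trans (ler_normD _ _))// !normrM lerD// ler_pM//.
    by rewrite ler_norml cos_geN1 cos_le1.
  by rewrite ler_norml sin_geN1 sin_le1.
have -> : 2 * (p * cos A + q * sin A) + (enorm z `^ @decay R d)^-1 * (p ^+ 2 + q ^+ 2)
    - 2 * (F * cos A + G * sin A) =
  2 * ((p - F) * cos A + (q - G) * sin A)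
    + (enorm z `^ @decay R d)^-1 * (p ^+ 2 + q ^+ 2) by ring.
rewrite /amplitude_error [X in _ <= X]mulrDl.
apply: (le_trans (ler_normD _ _)); apply: lerD.
  apply: (le_trans err); rewrite -[4 * E * _]mulrA ler_pM2l//.
  by rewrite ler_wpM2l.
rewrite ger0_norm ?mulr_ge0 ?invr_ge0 ?powR_ge0 ?addr_ge0 ?sqr_ge0//.
rewrite mulrAC; apply: ler_pM => //; rewrite ?invr_ge0 ?powR_ge0 ?addr_ge0 ?sqr_ge0//.
by apply: lerD; exact: sqr_le.
Qed.

(** With N = |r theta + zeta|, both bounds come from N^2 - r^2 = 2 r (theta, zeta) + |zeta|^2
    divided by N + r >= r. *)
Lemma enorm_shift_bound theta zeta : enorm theta = 1 ->
  exists2 K : R, 0 <= K & forall r : R, 1 <= r ->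
    `|enorm (r *: theta + zeta) - r| <= K /\
    `|enorm (r *: theta + zeta) - r - dot theta zeta| <= K / r.
Proof.
move=> th1; have tt : dot theta theta = 1 by rewrite -sqr_enorm th1 expr1n.
set c := dot theta zeta; set Z := dot zeta zeta.
have Z0 : 0 <= Z := dot_ge0 zeta.
pose K1 := 2 * `|c| + Z; have K10 : 0 <= K1 by rewrite addr_ge0 ?mulr_ge0.
pose K2 := Z + `|c| * K1; have K20 : 0 <= K2 by rewrite addr_ge0 ?mulr_ge0.
exists (K1 + K2); first exact: addr_ge0.
move=> r r1; have r0 : 0 < r by rewrite (lt_le_trans _ r1).
set N := enorm _; have N0 : 0 <= N := enorm_ge0 _.
have Nr : 0 < N + r by rewrite ltr_wpDl.
have NN : N ^+ 2 = r ^+ 2 + 2 * r * c + Z.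
  rewrite sqr_enorm !(dotDl, dotDr, dotZl, dotZr) tt (dotC zeta theta) -/c -/Z.
  by ring.
have E1 : N - r = (2 * r * c + Z) / (N + r).
  apply: (mulIf (lt0r_neq0 Nr)); rewrite divfK ?lt0r_neq0//.
  by rewrite -subr_sqr NN; ring.
have E2 : N - r - c = (Z - c * (N - r)) / (N + r).
  apply: (mulIf (lt0r_neq0 Nr)); rewrite divfK ?lt0r_neq0// mulrBl -subr_sqr NN.
  by ring.
have inv (a : R) : 0 <= a -> a / (N + r) <= a / r.
  by move=> a0; rewrite ler_wpM2l// lef_pV2 ?posrE// lerDr.
have B1 : `|N - r| <= K1.
  rewrite E1 normrM normfV (gtr0_norm Nr) (le_trans (inv _ _))//.
  rewrite ler_pdivrMr// (le_trans (ler_normD _ _))// (ger0_norm Z0).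
  rewrite !normrM (gtr0_norm r0) (@gtr0_norm _ 2)// /K1.
  rewrite [X in _ <= X]mulrDl [2 * r * _]mulrAC lerD2l.
  by rewrite ler_peMr.
split; first by rewrite (le_trans B1)// lerDl.
apply: (@le_trans _ _ (K2 / r)); last first.
  by rewrite ler_wpM2r ?invr_ge0 ?(ltW r0)// lerDr.
rewrite E2 normrM normfV (gtr0_norm Nr) (le_trans (inv _ _))//.
rewrite ler_wpM2r ?invr_ge0 ?(ltW r0)// (le_trans (ler_normB _ _))//.
by rewrite (ger0_norm Z0) lerD2l normrM ler_wpM2l.
Qed.

Lemma direction_shift theta zeta (r K : R) : 0 < r ->
  r / 2 <= enorm (r *: theta + zeta) ->
  `|enorm (r *: theta + zeta) - r| <= K ->
  forall i, `|((enorm (r *: theta + zeta))^-1 *: (r *: theta + zeta)) 0 i - theta 0 i|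
    <= 2 * (`|zeta 0 i| + K * `|theta 0 i|) / r.
Proof.
move=> r0; set N := enorm _ => rN NK i.
have N0 : 0 < N by rewrite (lt_le_trans _ rN)// divr_gt0.
have -> : (N^-1 *: (r *: theta + zeta)) 0 i - theta 0 i =
    (zeta 0 i - (N - r) * theta 0 i) / N.
  by rewrite !mxE; field; rewrite lt0r_neq0.
have -> : 2 * (`|zeta 0 i| + K * `|theta 0 i|) / r =
    (`|zeta 0 i| + K * `|theta 0 i|) / (r / 2) by field; rewrite lt0r_neq0.
rewrite normrM normfV (gtr0_norm N0); apply: ler_pM => //.
- by rewrite invr_ge0 ltW.
- by rewrite (le_trans (ler_normB _ _))// lerD2l normrM ler_wpM2r.
- by rewrite lef_pV2 ?posrE ?divr_gt0.
Qed.

(** The vector [u] is the projection of v = kappa theta - k onto the hyperplane orthogonal to [w],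
    so (v, u) = |u|^2 and - (v, zeta) = alpha. Staying outside the excluded set gives |u| >= eps,
    hence a legitimate division. *)
Lemma zeta_vec_phase w k theta (kappa alpha eps : R) : unit_sphere w -> 0 < eps ->
  (half_sphere w `\` excluded w k kappa eps) theta ->
  dot k (zeta_vec w k kappa alpha theta)
    - kappa * dot theta (zeta_vec w k kappa alpha theta) = alpha.
Proof.
move=> w1 eps0 [hth nexc]; rewrite /zeta_vec.
have ww : dot w w = 1 by rewrite -sqr_enorm w1 expr1n.
set u := kappa *: para w theta - para w k.
have u0 : enorm u != 0.
  have : ~ (enorm (para w k - kappa *: para w theta) < eps) by move=> ?; apply: nexc.
  have -> : para w k - kappa *: para w theta = (-1) *: u by rewrite scaleN1r opprB.
  rewrite enormZ normrN1 mul1r => /negP; rewrite -leNgt => eu.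
  by rewrite lt0r_neq0// (lt_le_trans eps0).
pose v := kappa *: theta - k.
have uE : u = v - dot v w *: w.
  have -> : dot v w = kappa * dot theta w - dot k w.
    by rewrite /v dotDl dotZl -[- k]scaleN1r dotZl mulN1r.
  by rewrite /u /v /para /perp; apply/rowP => i; rewrite !mxE; ring.
have uu (x : 'rV[R]_d) : u = x - dot x w *: w -> dot x u = enorm u ^+ 2.
  move=> E; rewrite sqr_enorm E -scaleNr !(dotDl, dotDr, dotZl, dotZr) ww (dotC w x).
  by ring.
have -> : forall a : R, dot k (a *: u) - kappa * dot theta (a *: u) = - a * dot v u.
  by move=> a; rewrite !dotZr /v -[- k]scaleN1r dotDl !dotZl; ring.
by rewrite (uu _ uE) opprK divfK// expf_neq0.
Qed.

End PhaselessAmplitude.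

(** * Real and imaginary parts of the scattered field far from the obstacle *)

Section ScatteredField.
Context {R : realType} {d : nat}.
Implicit Types (x z theta zeta k : 'rV[R]_d) (psi f : 'rV[R]_d -> R[i]).
Implicit Types (U A : set 'rV[R]_d).

Lemma exterior_far A : bounded_set A ->
  exists2 M : R, 0 < M & forall x, M < enorm x -> exterior A x.
Proof.
move=> [M0 [_ HM0]]; pose M := `|M0| + 1.
have AM x : A x -> `|x| <= M.
  by apply: HM0; rewrite (le_lt_trans (ler_norm M0))// ltrDl.
have M_ge0 : 0 <= M by rewrite addr_ge0.
(* The square root converts the sup-norm bound into a Euclidean one; the summand 1 makes [S]
   positive. *)
pose S := Num.sqrt (d%:R * M ^+ 2) + 1.
have S0 : 0 < S by rewrite ltr_wpDl// sqrtr_ge0.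
have AS x : A x -> enorm x <= S.
  move=> /AM xM; apply: (@le_trans _ _ (Num.sqrt (d%:R * M ^+ 2))); last first.
    by rewrite lerDl.
  rewrite /enorm ler_sqrt ?mulr_ge0 ?sqr_ge0//.
  rewrite mulr_natl -[d in _ *+ d]card_ord -sumr_const ler_sum// => i _.
  rewrite -expr2 -[_ ^+ 2]real_normK ?num_real// ler_pXn2r ?nnegrE//.
  apply: le_trans xM; rewrite {2}/Num.norm/= mx_normrE.
  exact: (@le_bigmax _ _ _ 0 (fun i : 'I_1 * 'I_d => `|x i.1 i.2|) (0, i)).
have cl : closed [set y : 'rV[R]_d | enorm y <= S].
  apply: (@preimage_closed _ _ (enorm : 'rV[R]_d -> R) [set t | t <= S]).
    by move=> z _; exact: enorm_continuous.
  exact: closed_le.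
exists S => // x; rewrite ltNge => /negP Sx [/AS//|[clAx _]].
by apply/Sx/cl; apply: (closure_subset (A := A)) clAx => y /AS.
Qed.

Let RePart psi x : R := complex.Re (psi x).
Let ImPart psi x : R := complex.Im (psi x).

Lemma Re_le_normc (z : R[i]) : `|complex.Re z| <= normc z.
Proof.
case: z => a b /=; rewrite -sqrtr_sqr ler_sqrt ?addr_ge0 ?sqr_ge0//.
by rewrite lerDl sqr_ge0.
Qed.

Lemma Im_le_normc (z : R[i]) : `|complex.Im z| <= normc z.
Proof.
case: z => a b /=; rewrite -sqrtr_sqr ler_sqrt ?addr_ge0 ?sqr_ge0//.
by rewrite lerDr sqr_ge0.
Qed.

(** Multiplying the expansion by |x|^m exp(- i kappa |x|) isolates f, and m - (d + 1) / 2 = - 1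
    gives the rate. *)
Lemma demod_far psi f (kappa : R) x (C : R) : 0 < enorm x ->
  normc (psi x - expi (kappa * enorm x) / (enorm x `^ @decay R d)%:C
                   * f ((enorm x)^-1 *: x))
    <= C * enorm x `^ (- ((d%:R + 1) / 2)) ->
  `|enorm x `^ @decay R d * demodRe kappa (RePart psi) (ImPart psi) x
     - RePart f ((enorm x)^-1 *: x)| <= C / enorm x /\
  `|enorm x `^ @decay R d * demodIm kappa (RePart psi) (ImPart psi) x
     - ImPart f ((enorm x)^-1 *: x)| <= C / enorm x.
Proof.
move=> x0 H; set N := enorm x `^ @decay R d.
have N0 : 0 < N by rewrite powR_gt0.
set D := psi x - _ in H.
pose e : R[i] := cos (kappa * enorm x) -i* sin (kappa * enorm x).
have ne : normc e = 1.
  by rewrite /e /= sqrrN cos2Dsin2 sqrtr1.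
have bound : normc (N%:C * e * D) <= C / enorm x.
  rewrite !normcM ne mulr1 /= expr0n addr0 sqrtr_sqr gtr0_norm//.
  apply: (le_trans (ler_wpM2l (ltW N0) H)).
  rewrite mulrCA /N -powRD ?lt0r_neq0 ?implybT//.
  have -> : @decay R d + - ((d%:R + 1) / 2) = -1 by rewrite /decay; field.
  by rewrite powR_inv1 ?(ltW x0).
have DE : N%:C * e * D =
    (N * demodRe kappa (RePart psi) (ImPart psi) x - RePart f ((enorm x)^-1 *: x))
  +i* (N * demodIm kappa (RePart psi) (ImPart psi) x - ImPart f ((enorm x)^-1 *: x)).
  rewrite /D /e /expi -/N -rmorphV ?unitfE ?lt0r_neq0// /demodRe /demodIm /RePart /ImPart.
  have := cos2Dsin2 (kappa * enorm x).
  move: (cos _) (sin _) => c s cs.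
  case: (psi x) => P Q; case: (f _) => F G.
  apply/eqP; rewrite eq_complex /=; apply/andP; split; apply/eqP.
    rewrite -[in RHS](mul1r F) -cs; field; exact: lt0r_neq0.
  rewrite -[in RHS](mul1r G) -cs; field; exact: lt0r_neq0.
split.
  by apply: le_trans bound; rewrite DE; exact: le_trans (Re_le_normc _).
by apply: le_trans bound; rewrite DE; exact: le_trans (Im_le_normc _).
Qed.

Lemma class_C2_partials U (g : 'rV[R]_d -> R) : class_C 2 U g ->
  let g1 i := 'D_(base i) g in
  let g2 i := 'D_(base i) (g1 i) in
  forall x, U x -> [/\ {for x, continuous g},
    forall i, is_derive x (base i) g (g1 i x),
    forall i, is_derive x (base i) (g1 i) (g2 i x)
  & forall i, {for x, continuous (g1 i)}].
Proof.
move=> [cg dg] g1 g2 x Ux; split=> [|i|i|i]; first exact: cg.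
- by have [dgi _] := dg i; apply: derivableP; exact: dgi.
- have [_ [_ d1]] := dg i; have [d1i _] := d1 i.
  by apply: derivableP; exact: d1i.
- by have [_ [c1 _]] := dg i; exact: c1.
Qed.

Lemma helmholtz_parts psi (kappa : R) x :
  - claplacian psi x = (kappa ^+ 2)%:C * psi x ->
  \sum_i 'D_(base i) ('D_(base i) (RePart psi)) x = - kappa ^+ 2 * RePart psi x /\
  \sum_i 'D_(base i) ('D_(base i) (ImPart psi)) x = - kappa ^+ 2 * ImPart psi x.
Proof.
have Re_sum (F : 'I_d -> R[i]) :
    complex.Re (\sum_i F i) = \sum_i complex.Re (F i).
  by elim/big_rec2: _ => // i a b _; case: (F i) (b) => p q [s t] /= <-.
have Im_sum (F : 'I_d -> R[i]) :
    complex.Im (\sum_i F i) = \sum_i complex.Im (F i).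
  by elim/big_rec2: _ => // i a b _; case: (F i) (b) => p q [s t] /= <-.
move=> H.
have HL : claplacian psi x = - (kappa ^+ 2)%:C * psi x by rewrite mulNr -H opprK.
have ReM (a : R) (z : R[i]) : complex.Re (- a%:C * z) = - a * complex.Re z.
  by case: z => p q /=; ring.
have ImM (a : R) (z : R[i]) : complex.Im (- a%:C * z) = - a * complex.Im z.
  by case: z => p q /=; ring.
split.
  by have := congr1 (@complex.Re R) HL; rewrite Re_sum ReM.
by have := congr1 (@complex.Im R) HL; rewrite Im_sum ImM.
Qed.

End ScatteredField.

(** * Lipschitz pattern of a radiation solution and inversion from two points *)

Section Reconstruction.
Context {R : realType} {d : nat}.
Implicit Types (x z theta zeta k : 'rV[R]_d) (psi f : 'rV[R]_d -> R[i]).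

Let RePart psi x : R := complex.Re (psi x).
Let ImPart psi x : R := complex.Im (psi x).

Lemma far_field_pattern_lipschitz (Omega : set 'rV[R]_d) psi f (kappa : R) theta :
  (2 <= d)%N -> bounded_set Omega -> 0 < kappa ->
  radiation_solution (exterior Omega) kappa psi ->
  far_field_pattern (exterior Omega) kappa psi f -> enorm theta = 1 ->
  exists A r C R0 : R, [/\ [/\ 0 <= A, 0 < r, 0 <= C & 0 < R0],
    forall x, R0 < enorm x ->
      `|enorm x `^ @decay R d * demodRe kappa (RePart psi) (ImPart psi) x
        - RePart f ((enorm x)^-1 *: x)| <= C / enorm x /\
      `|enorm x `^ @decay R d * demodIm kappa (RePart psi) (ImPart psi) x
        - ImPart f ((enorm x)^-1 *: x)| <= C / enorm x
    & forall x, enorm x = 1 -> box theta r x ->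
      `|RePart f x - RePart f theta| <= A * \sum_i `|x 0 i - theta 0 i| /\
      `|ImPart f x - ImPart f theta| <= A * \sum_i `|x 0 i - theta 0 i|].
Proof.
move=> d2 bO kappa0 [[cRe cIm] helm _] [C0 [M1 [_ far0]]] th1.
have [M0 M00 ext] := exterior_far bO.
(* Beyond both the threshold of the far-field expansion and a ball containing the obstacle. The
   absolute values here and in [C] are there because [M1] and [C0] carry no sign. *)
pose R0 := `|M1| + M0; have R00 : 0 < R0 by rewrite ltr_wpDl.
pose C := `|C0|.
have ext0 x : R0 < enorm x -> exterior Omega x.
  by move=> xR; apply: ext; rewrite (le_lt_trans _ xR)// lerDr.
have gt0 x : R0 < enorm x -> 0 < enorm x by exact: lt_trans.
have far x : R0 < enorm x ->
    `|enorm x `^ @decay R d * demodRe kappa (RePart psi) (ImPart psi) x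
      - RePart f ((enorm x)^-1 *: x)| <= C / enorm x /\
    `|enorm x `^ @decay R d * demodIm kappa (RePart psi) (ImPart psi) x
      - ImPart f ((enorm x)^-1 *: x)| <= C / enorm x.
  move=> xR; apply: demod_far (gt0 _ xR) _.
  apply: (@le_trans _ _ (C0 * enorm x `^ (- ((d%:R + 1) / 2)))).
    apply: (far0 (enorm x)) => //; last exact: ext0.
    rewrite (le_lt_trans (ler_norm M1))// (le_lt_trans _ xR)// lerDl.
    exact: ltW.
  by rewrite ler_wpM2r ?powR_ge0// ler_norm.
have pRe x xR := class_C2_partials cRe (ext0 x xR).
have pIm x xR := class_C2_partials cIm (ext0 x xR).
have hz x xR := helmholtz_parts (helm x (ext0 x xR)).
pose P1 i := 'D_(base i) (RePart psi).
pose Q1 i := 'D_(base i) (ImPart psi).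
pose P2 i := 'D_(base i) (P1 i).
pose Q2 i := 'D_(base i) (Q1 i).
have dP x i : R0 < enorm x -> is_derive x (base i) (RePart psi) (P1 i x).
  by move=> /pRe[].
have dQ x i : R0 < enorm x -> is_derive x (base i) (ImPart psi) (Q1 i x).
  by move=> /pIm[].
have dP1 x i : R0 < enorm x -> is_derive x (base i) (P1 i) (P2 i x).
  by move=> /pRe[].
have dQ1 x i : R0 < enorm x -> is_derive x (base i) (Q1 i) (Q2 i x).
  by move=> /pIm[].
have lapP x : R0 < enorm x -> \sum_i P2 i x = - kappa ^+ 2 * RePart psi x.
  by move=> /hz[].
have lapQ x : R0 < enorm x -> \sum_i Q2 i x = - kappa ^+ 2 * ImPart psi x.
  by move=> /hz[].
have cP x : R0 < enorm x -> {for x, continuous (RePart psi)} by move=> /pRe[].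
have cQ x : R0 < enorm x -> {for x, continuous (ImPart psi)} by move=> /pIm[].
have cP1 x i : R0 < enorm x -> {for x, continuous (P1 i)}.
  by move=> /pRe[_ _ _ /(_ i)].
have cQ1 x i : R0 < enorm x -> {for x, continuous (Q1 i)}.
  by move=> /pIm[_ _ _ /(_ i)].
have d0 : (0 < d)%N by exact: ltnW.
have C0' : 0 <= C by exact: normr_ge0.
have [A1 [r1 [A10 r10 lip1]]] := far_field_lipschitz kappa0 R00 dP dQ dP1 dQ1
  lapP lapQ cP cQ cP1 cQ1 d0 C0' (fun x xR => (far x xR).1)
  (fun x xR => (far x xR).2) th1.
(* The imaginary part is the real part of the pattern of - i psi. *)
have demN x : demodRe kappa (ImPart psi) (- RePart psi) x =
    demodIm kappa (RePart psi) (ImPart psi) x.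
  by rewrite /demodRe /demodIm !fctE; ring.
have demN' x : demodIm kappa (ImPart psi) (- RePart psi) x =
    - demodRe kappa (RePart psi) (ImPart psi) x.
  by rewrite /demodRe /demodIm !fctE; ring.
have [A2 [r2 [A20 r20 lip2]]] : exists A r : R, [/\ 0 <= A, 0 < r &
    forall x, enorm x = 1 -> box theta r x ->
    `|ImPart f x - ImPart f theta| <= A * \sum_i `|x 0 i - theta 0 i|].
  apply: (@far_field_lipschitz R d kappa R0 (ImPart psi) (- RePart psi)
    Q1 Q2 (fun i => - P1 i) (fun i => - P2 i) kappa0 R00 dQ _ dQ1 _ lapQ _ cQ _ cQ1 _
    (ImPart f) (fun x => - RePart f x) C d0 C0' _ _ _ th1).
  - by move=> x i xR; exact: is_deriveN (dP x i xR).
  - by move=> x i xR; exact: is_deriveN (dP1 x i xR).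
  - move=> x xR; under eq_bigr do rewrite fctE.
    by rewrite sumrN lapP// !fctE mulrN.
  - by move=> x xR; exact: continuousN (cP x xR).
  - by move=> x i xR; exact: continuousN (cP1 x i xR).
  - by move=> x xR; rewrite demN; exact: (far x xR).2.
  - by move=> x xR; rewrite demN' mulrN -opprD normrN; exact: (far x xR).1.
exists (A1 + A2), (Num.min r1 r2), C, R0.
split; first by split; rewrite ?addr_ge0// lt_min r10.
  exact: far.
move=> x x1 bx.
have S0 : 0 <= \sum_i `|x 0 i - theta 0 i| by rewrite sumr_ge0.
have b1 : box theta r1 x by move=> i; rewrite (le_trans (bx i))// ge_min lexx.
have b2 : box theta r2 x by move=> i; rewrite (le_trans (bx i))// ge_min lexx orbT.
split.
  by rewrite (le_trans (lip1 x x1 b1))// ler_wpM2r// lerDl.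
by rewrite (le_trans (lip2 x x1 b2))// ler_wpM2r// lerDr.
Qed.

Lemma normc_expi (t : R) : normc (expi t) = 1.
Proof. by rewrite /expi /= cos2Dsin2 sqrtr1. Qed.

Lemma normc_real (t : R) : normc t%:C = `|t|.
Proof. by rewrite /= expr0n addr0 sqrtr_sqr. Qed.

(* The two equations a = 2 Re (exp (- i A) f) + e1, b = 2 Re (exp (- i B) f) + e2
   solved for f by Cramer's rule. *)
Lemma two_point_inversion (f : R[i]) (A B e1 e2 a b sa : R) :
  a = 2 * (complex.Re f * cos A + complex.Im f * sin A) + e1 ->
  b = 2 * (complex.Re f * cos B + complex.Im f * sin B) + e2 ->
  sin (B - A) != 0 ->
  2 * 'i%C * sa%:C * (f - (2 * 'i%C * (sin (B - A))%:C)^-1 *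
    (expi B * a%:C - expi A * b%:C)) =
  (sa / sin (B - A))%:C * (expi A * e2%:C - expi B * e1%:C).
Proof.
move=> -> -> s0; set s := sin (B - A); set D := 2 * 'i%C * s%:C.
have D0 : D != 0.
  rewrite /D !mulf_eq0 !negb_or pnatr_eq0/= neq0Ci /=.
  by rewrite eq_complex /= eqxx andbT.
have -> : 2 * 'i%C * sa%:C = (sa / s)%:C * D.
  by rewrite /D mulrCA -rmorphM divfK.
rewrite -mulrA; congr (_ * _); rewrite mulrBr mulVKf// /D /s sinB /expi.
case: f => F G /=; apply/eqP; rewrite eq_complex /=.
by apply/andP; split; apply/eqP; ring.
Qed.

End Reconstruction.

Theorem proposition2p4 (R : realType) (d : nat) (hd : (2 <= d)%N)
  (Omega : set 'rV[R]_d) (hOmega : bounded_smooth_domain Omega)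
  (hU : connected (exterior Omega))
  (omega : 'rV[R]_d) (homega : unit_sphere omega)
  (k : 'rV[R]_d) (kappa : R) (hk : enorm k = kappa) (hkappa : 0 < kappa)
  (alpha delta : R) (hdelta : 0 < delta) (halpha : delta <= `|sin alpha|)
  (eps : R) (heps : 0 < eps)
  (psi1 f1 : 'rV[R]_d -> R[i])
  (hpsi1 : radiation_solution (exterior Omega) kappa psi1)
  (hf1 : far_field_pattern (exterior Omega) kappa psi1 f1)
  (theta : 'rV[R]_d)
  (htheta : (half_sphere omega `\` excluded omega k kappa eps) theta) :
  exists rem : R -> R[i],
    (exists C : R, \forall r \near +oo_R,
       normc (rem r) <= C * r `^ (- sigma R d)) /\
    (\forall r \near +oo_R,
       f1 theta = f11 psi1 k (r *: theta) (zeta_vec omega k kappa alpha theta)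
                  + (2 * 'i%C * (sin alpha)%:C)^-1 * rem r).
Proof.
have th1 : enorm theta = 1 by case: htheta => [[]].
have bO : bounded_set Omega by case: hOmega.
have sa0 : 0 < `|sin alpha| by exact: lt_le_trans halpha.
have [A [r0 [C [R0 [[A0 r00 C0 R00] far lip]]]]] :=
  far_field_pattern_lipschitz hd bO hkappa hpsi1 hf1 th1.
set zeta := zeta_vec omega k kappa alpha theta.
have phase : dot k zeta - kappa * dot theta zeta = alpha :=
  zeta_vec_phase alpha homega heps htheta.
have [K K0 shift] := enorm_shift_bound zeta th1.
pose S := \sum_i 2 * (`|zeta 0 i| + K * `|theta 0 i|).
have S0 : 0 <= S by apply: sumr_ge0 => i _; rewrite mulr_ge0// addr_ge0// mulr_ge0.
(* At y the expansion costs 2 C / r, as |y| >= r / 2, and replacing f1(y / |y|) by f1(theta) costs A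
   S / r. *)
pose E := 2 * C + A * S.
have E0 : 0 <= E by rewrite addr_ge0 ?mulr_ge0.
pose F := complex.Re (f1 theta); pose G := complex.Im (f1 theta).
pose AE := @amplitude_error R d E F G.
(* Once the phase is within [eta] of alpha, D is nonzero and sin alpha over its sine is at most 2 in
   size. *)
have [eta eta0 sin_eta] : exists2 eta : R, 0 < eta &
    forall t, `|alpha - t| < eta -> `|sin alpha| / 2 < `|sin t|.
  have cs : {for alpha, continuous (fun t : R => `|sin t|)}.
    apply: continuous_comp; first exact: continuous_sin.
    exact: norm_continuous.
  have : \forall t \near alpha, `|sin alpha| / 2 < `|sin t|.
    by apply: (cvgr_gt _ cs); rewrite gtr_pMr// invf_lt1// ltr1n.
  by move=> /nbhs_ballP[eta /= eta0 H]; exists eta => // t /H.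
(* With this choice the identity holds for every r because sin alpha is nonzero; the content is the
   bound. *)
pose rem (r : R) : R[i] :=
  2 * 'i%C * (sin alpha)%:C * (f1 theta - f11 psi1 k (r *: theta) zeta).
exists rem; split; last first.
  near=> r; rewrite /rem mulKf ?subrKC// !mulf_eq0 !negb_or pnatr_eq0 neq0Ci /=.
  by rewrite eq_complex /= eqxx andbT -normr_gt0.
(* A factor 2 for the quotient of the sines, and another for the errors at the two points. *)
exists (4 * AE).
(* One summand per threshold: r >= 1; |y| >= r / 2; x and y beyond [R0]; y / |y| in the box where
   the Lipschitz bound holds; phase within [eta] of alpha. *)
pose M := 1 + 2 * K + 2 * R0 + S / r0 + kappa * K / eta.
have M1 : 0 <= 2 * K by rewrite mulr_ge0.
have M2 : 0 <= 2 * R0 by rewrite mulr_ge0// ltW.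
have M3 : 0 <= S / r0 by rewrite divr_ge0// ltW.
have M4 : 0 <= kappa * K / eta by rewrite divr_ge0 ?mulr_ge0// ltW.
exists M; split; first exact: num_real.
move=> r; rewrite /M => Mr.
have r1 : 1 <= r by lra.
have rgt0 : 0 < r by lra.
have rK : 2 * K <= r by lra.
have rR : 2 * R0 < r by lra.
have rS : S / r <= r0.
  by rewrite ler_pdivrMr// mulrC -ler_pdivrMr//; lra.
have rk : kappa * (K / r) < eta.
  by rewrite mulrA ltr_pdivrMr// [eta * r]mulrC -ltr_pdivrMr//; lra.
pose x := r *: theta; pose y := x + zeta.
have Nx : enorm x = r by rewrite enormZ th1 mulr1 gtr0_norm.
have [yK yK'] := shift r r1.
have yr : r / 2 <= enorm y.
  by move: yK; rewrite -/x -/y ler_norml => /andP[+ _]; lra.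
have y0 : 0 < enorm y by rewrite (lt_le_trans _ yr)// divr_gt0.
have dir := direction_shift rgt0 yr yK.
set y' := _ *: _ in dir.
have dirS i : `|y' 0 i - theta 0 i| <= S / r.
  apply: (le_trans (dir i)); rewrite ler_wpM2r ?invr_ge0 ?(ltW rgt0)//.
  rewrite /S (bigD1 i)//= lerDl sumr_ge0// => j _.
  by rewrite mulr_ge0// addr_ge0// mulr_ge0.
have y'1 : enorm y' = 1.
  by rewrite /y' enormZ normfV gtr0_norm// mulVf// lt0r_neq0.
have y'S : A * (\sum_i `|y' 0 i - theta 0 i|) <= A * S / r.
  rewrite -mulrA ler_wpM2l// /S mulr_suml; apply: ler_sum => i _; exact: dir.
have [lipF lipG] := lip y' y'1 (fun i => le_trans (dirS i) rS).
have [|faryF faryG] := far y; first by apply: lt_le_trans yr; lra.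
have [|farxF farxG] := far x; first by rewrite Nx; lra.
have xth : (enorm x)^-1 *: x = theta.
  by rewrite Nx scalerA mulVf ?scale1r// lt0r_neq0.
rewrite xth Nx in farxF farxG.
have rhalf : r / 2 <= r by lra.
have CE : C / r <= E / r.
  rewrite ler_wpM2r ?invr_ge0 ?(ltW rgt0)// /E.
  have := mulr_ge0 A0 S0; lra.
have Cy : C / enorm y <= 2 * C / r.
  have -> : 2 * C / r = C / (r / 2) by field; rewrite lt0r_neq0.
  by rewrite ler_wpM2l// lef_pV2 ?posrE ?divr_gt0.
have tri (a b c : R) : `|a - b| <= C / enorm y -> `|b - c| <= A * S / r ->
    `|a - c| <= E / r.
  move=> ab bc; rewrite -[a](subrK b) -addrA (le_trans (ler_normD _ _))//.
  by rewrite /E mulrDl lerD// (le_trans ab).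
have ax := @a_fun_estimate R d psi1 k kappa x F G E r hd r1.
rewrite Nx in ax.
have {}ax := ax rhalf E0 (le_trans farxF CE) (le_trans farxG CE).
have ay := a_fun_estimate k hd r1 yr E0
  (tri _ _ _ faryF (le_trans lipF y'S)) (tri _ _ _ faryG (le_trans lipG y'S)).
move: ax ay; set Ax := dot k x - _; set By := dot k y - _.
set e := AE * _ => ax ay.
have tE : dot k zeta + enorm k * enorm x - enorm k * enorm y = By - Ax.
  by rewrite /By /Ax hk Nx /y dotDr; ring.
have sinBA : `|sin alpha| / 2 < `|sin (By - Ax)|.
  apply: sin_eta; apply: le_lt_trans rk.
  (* The phase misses alpha exactly by kappa times the second-order remainder of |y|, which is at
     most K / r. *)
  have -> : alpha - (By - Ax) = kappa * (enorm y - r - dot theta zeta).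
    by rewrite -phase -tE hk Nx; ring.
  by rewrite normrM (gtr0_norm hkappa) ler_wpM2l// ltW.
have s_gt0 : 0 < `|sin (By - Ax)| by apply: lt_trans sinBA; rewrite divr_gt0.
(* The errors are taken to be the data minus their leading terms, so both equations of the system
   hold trivially. *)
have remE := @two_point_inversion R (f1 theta) Ax By _ _ (a_fun psi1 k x)
  (a_fun psi1 k y) (sin alpha) (esym (subrKC _ _)) (esym (subrKC _ _)).
have -> : rem r = (sin alpha / sin (By - Ax))%:C *
    (expi Ax * (a_fun psi1 k y - 2 * (F * cos By + G * sin By))%:C
   - expi By * (a_fun psi1 k x - 2 * (F * cos Ax + G * sin Ax))%:C).
  rewrite -remE; last by rewrite -normr_gt0.
  by rewrite /rem /f11 -/x -/y tE hk Nx -/By.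
have normcB (u v : R[i]) : normc (u - v) <= normc u + normc v.
  apply: (le_trans (le_normcD _ _)); rewrite lerD2l.
  by case: v => p q /=; rewrite !sqrrN.
rewrite normcM normc_real normrM normfV.
have q2 : `|sin alpha| / `|sin (By - Ax)| <= 2 by rewrite ler_pdivrMr//; lra.
have -> : 4 * AE * r `^ (- sigma R d) = 2 * (e + e) by rewrite /e; ring.
apply: ler_pM => //; first by case: (_ - _) => p q /=; exact: sqrtr_ge0.
apply: (le_trans (normcB _ _)); rewrite !normcM !normc_expi !mul1r !normc_real.
exact: lerD.
Unshelve. all: by end_near. Qed.
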